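(* Let $F$ be a cumulative distribution function of a probability distribution supported on $\mathcal{S}$, twice continuously differentiable on $\mathcal{S}$. Let $\boldsymbol{X}_1,\boldsymbol{X}_2,\dots$ be i.i.d. with c.d.f. $F$, and let $m=m(n)$ be positive integers with $m(n)\to\infty$ as $n\to\infty$. Then, as $n\to\infty$, $$\mathbb{E}[F_{n,m}^{\star}(\boldsymbol{x})] - F(\boldsymbol{x}) = m^{-1}B(\boldsymbol{x}) + \mathrm{o}(m^{-1})\quad\text{for all }\boldsymbol{x}\in\mathcal{S},$$ and, for every $\boldsymbol{x}\in\mathrm{Int}(\mathcal{S})$, $$\mathrm{Var}(F_{n,m}^{\star}(\boldsymbol{x})) = n^{-1}\sigma^2(\boldsymbol{x}) - n^{-1}m^{-1/2}V(\boldsymbol{x}) + \mathrm{o}_{\boldsymbol{x}}(n^{-1}m^{-1/2}),$$ where $B(\boldsymbol{x}) := \frac12\sum_{i,j=1}^d(x_i\mathbf{1}_{\{i=j\}}-x_ix_j)\frac{\partial^2}{\partial x_i\partial x_j}F(\boldsymbol{x})$, $\sigma^2(\boldsymbol{x}) := F(\boldsymbol{x})(1-F(\boldsymbol{x}))$ and $V(\boldsymbol{x}) := \sum_{i=1}^d \frac{\partial}{\partial x_i}F(\boldsymbol{x})\sqrt{x_i(1-x_i)/\pi}$.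
   Context: Let $d\ge1$, $\|\boldsymbol{x}\|_1=\sum_i|x_i|$, $\mathcal{S}:=\{\boldsymbol{x}\in[0,1]^d:\|\boldsymbol{x}\|_1\le1\}$ and $\mathrm{Int}(\mathcal{S}):=\{\boldsymbol{x}\in(0,1)^d:\|\boldsymbol{x}\|_1<1\}$. For $m\in\mathbb{N}$ and $\boldsymbol{k}\in\mathbb{N}_0^d$ with $\|\boldsymbol{k}\|_1\le m$ (written $\boldsymbol{k}\in\mathbb{N}_0^d\cap m\mathcal{S}$), $P_{\boldsymbol{k},m}(\boldsymbol{x}) := \frac{m!}{(m-\|\boldsymbol{k}\|_1)!\prod_i k_i!}(1-\|\boldsymbol{x}\|_1)^{m-\|\boldsymbol{k}\|_1}\prod_i x_i^{k_i}$. The empirical c.d.f. is $F_n(\boldsymbol{x}) := n^{-1}\sum_{i=1}^n\mathbf{1}\{\boldsymbol{X}_i\le\boldsymbol{x}\}$ (componentwise inequality), and the Bernstein c.d.f. estimator is $F_{n,m}^{\star}(\boldsymbol{x}) := \sum_{\boldsymbol{k}\in\mathbb{N}_0^d\cap m\mathcal{S}}F_n(\boldsymbol{k}/m)P_{\boldsymbol{k},m}(\boldsymbol{x})$, $\boldsymbol{x}\in\mathcal{S}$. The notation $\mathrm{o}_{\boldsymbol{x}}$ indicates that the implied rate may depend on $\boldsymbol{x}$. *)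

(* Defs.v *)
From HB Require Import structures.
From mathcomp Require Import all_boot all_order all_algebra.
From mathcomp Require Import all_classical all_reals all_analysis.
Set Implicit Arguments. Unset Strict Implicit. Unset Printing Implicit Defensive.
Import Order.TTheory GRing.Theory Num.Theory.
Import numFieldNormedType.Exports.
Local Open Scope classical_set_scope.
Local Open Scope ring_scope.

Section defs.
Variable (R : realType) (d : nat).

Definition l1 (x : 'rV[R]_d) : R := \sum_(j < d) `|x ord0 j|.

Definition inS (x : 'rV[R]_d) : Prop :=
  (forall j, 0 <= x ord0 j <= 1) /\ l1 x <= 1.
Definition inIntS (x : 'rV[R]_d) : Prop :=
  (forall j, 0 < x ord0 j < 1) /\ l1 x < 1.

Definition ebasis (i : 'I_d) : 'rV[R]_d := delta_mx ord0 i.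
Definition partial (i : 'I_d) (f : 'rV[R]_d -> R) (x : 'rV[R]_d) : R :=
  'D_(ebasis i) f x.

Definition C2 (f : 'rV[R]_d -> R) : Prop :=
  continuous f /\
  forall i : 'I_d,
    (forall x, derivable f x (ebasis i)) /\ continuous (partial i f) /\
    forall j : 'I_d,
      (forall x, derivable (partial i f) x (ebasis j)) /\
      continuous (partial j (partial i f)).

Definition boxes : set (set 'rV[R]_d) :=
  [set B | exists A : 'I_d -> set R,
     (forall j, measurable (A j)) /\ B = [set y : 'rV[R]_d | forall j, A j (y ord0 j)]].
Definition borel_Rd (A : set 'rV[R]_d) : Prop := <<s boxes >> A.

Definition le_vec (x y : 'rV[R]_d) : bool := [forall j, x ord0 j <= y ord0 j].

(* Bernstein weight P_{k,m}(x), k : 'I_d -> 'I_(m.+1) with |k|_1 <= m *)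
Definition ksum m (k : {ffun 'I_d -> 'I_m.+1}) : nat := (\sum_(j < d) (k j : nat))%N.
Definition bern_weight m (k : {ffun 'I_d -> 'I_m.+1}) (x : 'rV[R]_d) : R :=
  (m`!)%:R / (((m - ksum k)`!)%:R * \prod_(j < d) ((k j)`!)%:R)
  * (1 - l1 x) ^+ (m - ksum k) * \prod_(j < d) x ord0 j ^+ k j.
Definition kpoint m (k : {ffun 'I_d -> 'I_m.+1}) : 'rV[R]_d :=
  \row_j ((k j)%:R / m%:R).

Context {dT : measure_display} {T : measurableType dT}.
Variable (P : probability T R).

Definition mutually_independent (X : nat -> T -> 'rV[R]_d) : Prop :=
  forall (s : seq nat) (A : nat -> set 'rV[R]_d), uniq s ->
    (forall i, borel_Rd (A i)) ->
    P (\bigcap_(i in [set` s]) (X i @^-1` A i)) =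
      (\prod_(i <- s) P (X i @^-1` A i))%E.

Definition ecdf (X : nat -> T -> 'rV[R]_d) (n : nat) (y : 'rV[R]_d) (w : T) : R :=
  n%:R^-1 * \sum_(i < n) (le_vec (X i w) y)%:R.

Definition bernstein_cdf (X : nat -> T -> 'rV[R]_d) (n m : nat)
    (x : 'rV[R]_d) (w : T) : R :=
  \sum_(k : {ffun 'I_d -> 'I_m.+1} | (ksum k <= m)%N)
     ecdf X n (kpoint k) w * bern_weight k x.
End defs.

Section fns.
Variable (R : realType) (d : nat).
Definition Bfun (F : 'rV[R]_d -> R) (x : 'rV[R]_d) : R :=
  2^-1 * \sum_(i < d) \sum_(j < d)
    (((i == j)%:R * x ord0 i - x ord0 i * x ord0 j) * partial j (partial i F) x).
Definition sigma2 (F : 'rV[R]_d -> R) (x : 'rV[R]_d) : R := F x * (1 - F x).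
Definition Vfun (F : 'rV[R]_d -> R) (x : 'rV[R]_d) : R :=
  \sum_(i < d) partial i F x * Num.sqrt (x ord0 i * (1 - x ord0 i) / pi).
End fns.

(* Main.v *)
From HB Require Import structures.
From mathcomp Require Import all_boot all_order all_algebra.
From mathcomp Require Import all_classical all_reals all_analysis.
From mathcomp Require Import ring lra zify.
Require Import Defs.
Import Order.TTheory GRing.Theory Num.Theory.
Import numFieldNormedType.Exports.
Set Implicit Arguments. Unset Strict Implicit. Unset Printing Implicit Defensive.
Local Open Scope classical_set_scope.
Local Open Scope ring_scope.

(* The Bernstein weights are the probabilities of a multinomial vector K with m
   trials and success probabilities x.  Hence the mean of the estimator is
   E[F(K/m)], and the bias comes from a second-order Taylor expansion, the
   moments of K (covariance, and fourth moments for the remainder) and the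
   uniform continuity of the second derivatives on the unit cube.  With L an
   independent copy of K, n Var = E[F(min(K,L)/m)] - E[F(K/m)]^2, and a
   first-order expansion leaves the terms -E|K_i - L_i| / (2m).  The difference
   K_i - L_i is a simple random walk stopped after a binomial(m, 2x_i(1-x_i))
   number of steps; the mean absolute value a_N of that walk at time N is an
   explicit central binomial coefficient, and Wallis' product gives
   |(pi/2) a_N^2 - N| <= 1. *)

(** * Binomial expectations *)

(** [K] and [L] are never built as random variables: a mean is a functional defined by recursion on
    the number of trials, so moments, marginals and the law of $K_i - L_i$ all come from inductions
    on [m]. Taylor's formula is applied to the extension [G], known to agree with [F] only on the
    simplex; the replacement is sound for the variance too, because the simplex is stable under
    componentwise minimum. The second-order remainder is kept in the form $\varepsilon|h|^2 +
    C|h|^4$, which averages to $O(\varepsilon/m) + O(1/m^2)$ with constants independent of the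
    point. In the variance, $E|K_i - L_i|$ has order $\sqrt m$ and is divided by $2m$, so knowing it
    up to a bounded error is enough. *)

Section binomial_expectation.
Variable R : realType.
Implicit Types (p : R) (g h : nat -> R) (f : int -> R).

(* Mean of [g] under the binomial law with [m] trials, conditioning on one trial. *)
Fixpoint binE p m g : R :=
  if m is m'.+1 then (1 - p) * binE p m' g + p * binE p m' (g \o succn)
  else g 0%N.

Lemma eq_binE p m g h : g =1 h -> binE p m g = binE p m h.
Proof. by move=> /funext ->. Qed.

Lemma binE_linear p m a g h :
  binE p m (fun k => a * g k + h k) = a * binE p m g + binE p m h.
Proof. by elim: m g h => [|m IH] g h //=; rewrite /comp !IH; ring. Qed.

Lemma binE_cst p m a : binE p m (fun=> a) = a.
Proof. by elim: m => [|m IH] //=; rewrite /comp IH; ring. Qed.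

Lemma binED p m g h :
  binE p m (fun k => g k + h k) = binE p m g + binE p m h.
Proof.
rewrite -[binE p m g]mul1r -binE_linear.
by apply: eq_binE => k; rewrite mul1r.
Qed.

Lemma binEZ p m a g : binE p m (fun k => a * g k) = a * binE p m g.
Proof.
rewrite -[RHS]addr0 -(binE_cst p m 0) -binE_linear.
by apply: eq_binE => k; rewrite addr0.
Qed.

Lemma ler_binE p m g h : 0 <= p <= 1 ->
  (forall k, g k <= h k) -> binE p m g <= binE p m h.
Proof.
move=> /andP[p0 p1]; elim: m g h => [|m IH] g h gh //=.
by apply: lerD; apply: ler_wpM2l; rewrite ?subr_ge0//; apply: IH => k /=.
Qed.

Lemma ler_norm_binE p m g : 0 <= p <= 1 ->
  `|binE p m g| <= binE p m (fun k => `|g k|).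
Proof.
move=> p01; rewrite ler_norml -mulN1r -binEZ; apply/andP; split.
  by apply: ler_binE => // k; rewrite mulN1r lerNl -normrN ler_norm.
by apply: ler_binE => // k; exact: ler_norm.
Qed.

(** The free shift [c] lets the induction close: a failure in the conditioned trial replaces it by
    [c - p], a success by [c + 1 - p]. *)
Lemma binE_var p m c : binE p m (fun k => (k%:R - m%:R * p + c) ^+ 2) =
  c ^+ 2 + m%:R * (p * (1 - p)).
Proof.
elim: m c => [|m IH] c /=; first by ring.
rewrite (@eq_binE _ _ _ (fun k => (k%:R - m%:R * p + (c - p)) ^+ 2)); last first.
  by move=> k; rewrite -natr1; ring.
rewrite (@eq_binE _ _ (_ \o _) (fun k => (k%:R - m%:R * p + (c + 1 - p)) ^+ 2)); last first.
  by move=> k /=; rewrite -!natr1; ring.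
by rewrite !IH -natr1; ring.
Qed.

(** Read as a polynomial in [c], the right side has the central moments of orders 2, 3 and 4 as
    coefficients. *)
Lemma binE_fourth p m c : binE p m (fun k => (k%:R - m%:R * p + c) ^+ 4) =
  c ^+ 4 + 6 * c ^+ 2 * m%:R * (p * (1 - p))
  + 4 * c * m%:R * (p * (1 - p) * (1 - p *+ 2))
  + m%:R * (p * (1 - p) * (1 - 3 * (p * (1 - p))))
  + 3 * m%:R * (m%:R - 1) * (p * (1 - p)) ^+ 2.
Proof.
elim: m c => [|m IH] c /=; first by ring.
rewrite (@eq_binE _ _ _ (fun k => (k%:R - m%:R * p + (c - p)) ^+ 4)); last first.
  by move=> k; rewrite -natr1; ring.
rewrite (@eq_binE _ _ (_ \o _) (fun k => (k%:R - m%:R * p + (c + 1 - p)) ^+ 4)); last first.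
  by move=> k /=; rewrite -!natr1; ring.
by rewrite !IH -natr1; ring.
Qed.

Lemma binE_half_indic N j :
  binE 2^-1 N (fun i => (i == j)%:R) = 'C(N, j)%:R / 2 ^+ N.
Proof.
elim: N j => [|N IH] [|j] /=.
- by rewrite bin0 divr1.
- by rewrite bin_small// mul0r.
- rewrite IH (@eq_binE _ _ (_ \o _) (fun=> 0))// binE_cst !bin0 exprS invfM.
  by rewrite mulr0 addr0 !mul1r; congr (_ * _); lra.
- rewrite IH (@eq_binE _ _ (_ \o _) (fun i => (i == j)%:R))// IH.
  by rewrite binS natrD exprS; field.
Qed.

(** Transition operator of the symmetric simple random walk: its [N]-th iterate at [z] is the mean
    of [f] after [N] steps from [z]. *)
Definition avg f (z : int) : R := (f (z + 1) + f (z - 1)) / 2.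

Lemma iter_avgE N f z :
  iter N avg f z = binE 2^-1 N (fun i => f (z + i.*2%:Z - N%:Z)).
Proof.
elim: N z => [|N IH] z /=; first by rewrite addr0 subr0.
rewrite /avg !IH addrC mulrDl mulrC [_ / 2]mulrC.
congr (_ * _ + _ * _); [by field| |]; apply: eq_binE => i /=; congr f; lia.
Qed.

Lemma iter_avgD N f1 f2 z :
  iter N avg (fun x => f1 x + f2 x) z = iter N avg f1 z + iter N avg f2 z.
Proof. by rewrite !iter_avgE binED. Qed.

(* Mean distance to the origin of the simple random walk after [N] steps. *)
Definition absz_mean (N : nat) : R := iter N avg (fun z => `|z|%N%:R) 0.

Definition centralbin j : R := 'C(j.*2, j)%:R / 4 ^+ j.

(** The absolute value is harmonic for the walk except at the origin, where [avg] raises it by 1. So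
    the mean distance grows by the probability of being at 0 at time [N], which vanishes for odd
    [N]. *)
Lemma absz_meanS N : absz_mean N.+1 =
  absz_mean N + (if odd N then 0 else centralbin N./2).
Proof.
rewrite /absz_mean iterSr.
have -> : avg (fun z => `|z|%N%:R) = fun z => `|z|%N%:R + (z == 0)%:R.
  apply/funext => z; rewrite /avg; case: z => [[|n]|n].
  - by rewrite add0r sub0r abszN /= add0r divff.
  - rewrite (_ : absz (n.+1%:Z + 1) = n.+2); last by lia.
    rewrite (_ : absz (n.+1%:Z - 1) = n); last by lia.
    by rewrite [in RHS]/= addr0 -!natr1; field.
  - rewrite (_ : absz (Negz n + 1) = n); last by lia.
    rewrite (_ : absz (Negz n - 1) = n.+2); last by lia.
    by rewrite [in RHS]/= addr0 -!natr1; field.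
rewrite iter_avgD; congr (_ + _); rewrite iter_avgE; case: ifPn => [oN|eN].
  rewrite -[RHS](binE_cst 2^-1 N); apply: eq_binE => i.
  by case: eqP => //; lia.
rewrite (@eq_binE _ _ _ (fun i => (i == N./2)%:R)); last first.
  by move=> i; congr (nat_of_bool _)%:R; apply/eqP/eqP; lia.
rewrite binE_half_indic /centralbin.
have -> : N = (N./2).*2 by lia.
rewrite doubleK -[in 2 ^+ _]mul2n exprM.
by congr (_ / _ ^+ _); ring.
Qed.

Lemma centralbin_gt0 j : 0 < centralbin j.
Proof.
by rewrite divr_gt0 ?exprn_gt0// ltr0n bin_gt0 -addnn leq_addr.
Qed.

Lemma centralbinS j :
  j.+1.*2%:R * centralbin j.+1 = j.*2.+1%:R * centralbin j.
Proof.
rewrite /centralbin.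
have H : ((j.+1 * j.+1) * 'C(j.+1.*2, j.+1) = (j.*2.+2 * j.*2.+1) * 'C(j.*2, j))%N.
  have H2 := mul_bin_down j.*2.+1 j.
  rewrite /= (_ : j.*2.+1 - j = j.+1)%N in H2; last by lia.
  by rewrite doubleS -mulnA -mul_bin_diag/= mulnCA -H2 mulnA.
have {}H : j.+1%:R * j.+1%:R * 'C(j.+1.*2, j.+1)%:R
   = j.*2.+2%:R * j.*2.+1%:R * 'C(j.*2, j)%:R :> R by rewrite -!natrM H.
have j0 : j.+1%:R != 0 :> R by rewrite pnatr_eq0.
have e1 : j.*2.+2%:R = 2 * j.+1%:R :> R by rewrite -natrM; congr _%:R; lia.
have : j.+1%:R * 'C(j.+1.*2, j.+1)%:R = 2 * j.*2.+1%:R * 'C(j.*2, j)%:R :> R.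
  apply: (mulfI j0); rewrite mulrA H e1; ring.
rewrite -[j.+1.*2]/(j.*2.+2) e1 exprS invfM => H3.
have -> : 2 * j.+1%:R * ('C(j.*2.+2, j.+1)%:R * (4^-1 / 4 ^+ j)) =
  2 * (j.+1%:R * 'C(j.*2.+2, j.+1)%:R) * (4^-1 / 4 ^+ j) :> R by ring.
by rewrite H3; field; rewrite expf_neq0.
Qed.

(** The increments telescope: by [centralbinS], [j.+1.*2%:R * centralbin j.+1] exceeds
    [j.*2%:R * centralbin j] by exactly [centralbin j]. *)
Lemma absz_mean_double j : absz_mean j.*2 = j.*2%:R * centralbin j.
Proof.
elim: j => [|j IH]; first by rewrite mul0r.
rewrite centralbinS !doubleS !absz_meanS/= odd_double/= doubleK addr0 IH.
by rewrite -natr1; ring.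
Qed.
End binomial_expectation.

(** * Wallis' product and the mean difference of two binomials *)

Section wallis.
Variable R : realType.

(* Antiderivatives of the powers of [sin], vanishing at [0]. *)
Fixpoint sinpow_prim (n : nat) (x : R) : R :=
  match n with
  | 0 => x
  | n'.+1 => if n' is k.+1 then
      k.+2%:R^-1 * (k.+1%:R * sinpow_prim k x - cos x * sin x ^+ k.+1)
      else 1 - cos x
  end.

(** The recursion is the reduction formula from integration by parts; it has step 2, so two
    consecutive indices are carried through the induction. *)
Lemma is_derive_sinpow_prim n (x : R) :
  is_derive x 1 (sinpow_prim n) (sin x ^+ n).
Proof.
suff : is_derive x (1 : R) (sinpow_prim n) (sin x ^+ n) /\
  is_derive x 1 (sinpow_prim n.+1) (sin x ^+ n.+1) by case.
elim: n => [|n [IH1 IH2]].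
  rewrite expr0 expr1; split; first exact: is_derive_id.
  rewrite (_ : sinpow_prim 1 = cst 1 - cos)//.
  by apply: is_derive_eq; rewrite sub0r opprK.
split=> //.
rewrite (_ : sinpow_prim n.+2 = n.+2%:R^-1 *:
  (n.+1%:R *: sinpow_prim n - cos * sin ^+ n.+1)); last first.
  by apply/funext => y; rewrite /= !fctE.
apply: is_derive_eq.
rewrite /GRing.scale/= exprfctE.
have c2 : cos x ^+ 2 = 1 - sin x ^+ 2 by rewrite -(cos2Dsin2 x) addrK.
have -> : cos x * (n.+1%:R * sin x ^+ n * cos x) =
  n.+1%:R * sin x ^+ n * cos x ^+ 2 by ring.
by rewrite c2 !exprS -!natr1; field.
Qed.

Lemma sinpow_prim0 n : sinpow_prim n 0 = 0.
Proof.
suff : sinpow_prim n 0 = 0 /\ sinpow_prim n.+1 0 = 0 by case.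
elim: n => [|n [IH1 IH2]]; first by rewrite /= cos0 subrr.
by split=> //=; rewrite IH1 sin0 expr0n/= !mulr0 subr0 mulr0.
Qed.

Definition wallis_int n := sinpow_prim n (pi / 2).

Lemma wallis_int1 : wallis_int 1 = 1.
Proof. by rewrite /wallis_int/= cos_pihalf subr0. Qed.

Lemma wallis_intSS n : n.+2%:R * wallis_int n.+2 = n.+1%:R * wallis_int n.
Proof. by rewrite /wallis_int/= cos_pihalf mul0r subr0 mulVKf. Qed.

(** Instead of comparing integrals, the mean value theorem is applied to the difference of the
    antiderivatives, whose derivative $\sin^n c\,(1-\sin c)$ is nonnegative on $[0,\pi/2]$. *)
Lemma wallis_int_decr n : wallis_int n.+1 <= wallis_int n.
Proof.
have hpi : 0 <= pi / 2 :> R by rewrite divr_ge0 ?pi_ge0.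
have dF (x : R) : is_derive x 1 (sinpow_prim n - sinpow_prim n.+1)
    (sin x ^+ n - sin x ^+ n.+1).
  by apply: is_deriveB; exact: is_derive_sinpow_prim.
have [|c] := MVT_segment hpi (fun x _ => dF x).
  by apply: derivable_within_continuous => x _; apply: ex_derive.
rewrite in_itv/= => /andP[c0 c1].
rewrite -[(_ - _) (pi / 2)]/(wallis_int n - wallis_int n.+1).
rewrite -[(_ - _) 0]/(sinpow_prim n 0 - sinpow_prim n.+1 0).
rewrite 2!sinpow_prim0 !subr0 => E.
rewrite -subr_ge0 E mulr_ge0// exprS -{1}[sin c ^+ n]mul1r -mulrBl.
have s0 : 0 <= sin c.
  by apply: sin_ge0_pi; rewrite c0 (le_trans c1)// ler_pdivrMr// ler_peMr ?pi_ge0// ler1n.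
by rewrite mulr_ge0 ?exprn_ge0// subr_ge0 sin_le1.
Qed.

Lemma wallis_int_even j : wallis_int j.*2 = centralbin R j * (pi / 2).
Proof.
elim: j => [|j IH]; first by rewrite /centralbin bin0 expr0 divr1 mul1r.
apply: (@mulfI _ (j.+1.*2%:R)); first by rewrite pnatr_eq0.
by rewrite [RHS]mulrA centralbinS doubleS wallis_intSS IH [LHS]mulrA.
Qed.

Lemma wallis_int_odd j : j.*2.+1%:R * centralbin R j * wallis_int j.*2.+1 = 1.
Proof.
elim: j => [|j IH]; first by rewrite wallis_int1 /centralbin bin0 expr0 divr1 !mul1r.
rewrite -[RHS]IH mulrAC doubleS wallis_intSS mulrAC.
by rewrite -[j.*2.+2]/(j.+1.*2) centralbinS.
Qed.

(** Monotonicity from index $2j$ to $2j+1$; the upper bound below uses $2j+1$ to $2j+2$. *)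
Lemma centralbin_ge j : 1 <= j.*2.+1%:R * centralbin R j ^+ 2 * (pi / 2).
Proof.
rewrite -[leLHS](wallis_int_odd j).
have -> : j.*2.+1%:R * centralbin R j ^+ 2 * (pi / 2) =
  j.*2.+1%:R * centralbin R j * wallis_int j.*2 by rewrite wallis_int_even; ring.
by rewrite ler_wpM2l ?wallis_int_decr// mulr_ge0// ltW// centralbin_gt0.
Qed.

Lemma centralbin_le j :
  j.*2.+1%:R ^+ 2 * centralbin R j ^+ 2 * (pi / 2) <= j.*2.+2%:R.
Proof.
have -> : j.*2.+2%:R =
  j.*2.+2%:R * (j.*2.+1%:R * centralbin R j * wallis_int j.*2.+1) :> R.
  by rewrite wallis_int_odd mulr1.
have -> : j.*2.+1%:R ^+ 2 * centralbin R j ^+ 2 * (pi / 2) =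
  j.*2.+1%:R * centralbin R j * (j.*2.+2%:R * wallis_int j.*2.+2).
  rewrite -doubleS wallis_int_even [X in _ = _ * X]mulrA centralbinS; ring.
by rewrite [leRHS]mulrCA !ler_wpM2l ?mulr_ge0 ?wallis_int_decr// ltW// centralbin_gt0.
Qed.

(** With $N=2j$ and $t=\frac{\pi}{2}c_j^2$, where $c_j$ is [centralbin R j], Wallis gives
    $(N+1)t\ge1$ and $(N+1)^2t\le N+2$. Then $N^2t\ge N^2/(N+1)\ge N-1$ and $N^2t\le
    N^2(N+2)/(N+1)^2\le N$. *)
Lemma absz_mean_double_bounds j : let a := pi / 2 * absz_mean R j.*2 ^+ 2 in
  j.*2%:R - 1 <= a <= j.*2%:R.
Proof.
rewrite /= absz_mean_double exprMn.
have := centralbin_ge j; have := centralbin_le j.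
have -> : j.*2.+2%:R = j.*2%:R + 1 + 1 :> R by rewrite !natr1.
rewrite -(natr1 j.*2).
set N : R := j.*2%:R; set c := centralbin R j ^+ 2; set p := pi / 2.
have N0 : 0 <= N by rewrite /N.
have -> : (N + 1) ^+ 2 * c * p = (N + 1) ^+ 2 * (c * p) by ring.
have -> : (N + 1) * c * p = (N + 1) * (c * p) by ring.
have -> : p * (N ^+ 2 * c) = N ^+ 2 * (c * p) by ring.
move: (c * p) => t h1 h2.
have N1 : 0 < N + 1 by rewrite ltr_wpDl.
apply/andP; split.
  rewrite -(ler_pM2l N1); apply: (@le_trans _ _ (N ^+ 2)); first by lra.
  have -> : (N + 1) * (N ^+ 2 * t) = N ^+ 2 * ((N + 1) * t) by ring.
  by rewrite ler_peMr// sqr_ge0.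
rewrite -(@ler_pM2l _ ((N + 1) ^+ 2)) ?exprn_gt0//.
apply: (@le_trans _ _ (N ^+ 2 * (N + 1 + 1))); last by nra.
by rewrite mulrCA ler_wpM2l ?sqr_ge0.
Qed.

Lemma absz_mean_ge0 N : 0 <= absz_mean R N.
Proof.
elim: N => [|N IH]; first by rewrite /absz_mean.
by rewrite absz_meanS addr_ge0//; case: ifP => // _; exact/ltW/centralbin_gt0.
Qed.

Lemma absz_mean_sqr N : `|pi / 2 * absz_mean R N ^+ 2 - N%:R| <= 1.
Proof.
case: (boolP (odd N)) => oN.
  (* At odd times the walk is not at 0, so the mean at $N$ equals that at the even time $N+1$, whose
     bounds are $N$ and $N+1$. *)
  have := absz_mean_double_bounds N./2.+1.
  have E : N./2.+1.*2 = N.+1 by rewrite doubleS; lia.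
  rewrite E absz_meanS oN addr0 -(natr1 N) addrK => /andP[h1 h2].
  by rewrite ler_norml; apply/andP; split; lra.
have := absz_mean_double_bounds N./2.
have -> : N./2.*2 = N by lia.
by move=> /andP[h1 h2]; rewrite ler_norml; apply/andP; split; lra.
Qed.

(** $|u^2-v^2| = |u-v|(u+v)\ge|u-v|^2$ for nonnegative numbers. *)
Lemma ler_dist_sqr (u v : R) : 0 <= u -> 0 <= v ->
  `|u ^+ 2 - v ^+ 2| <= 1 -> `|u - v| <= 1.
Proof.
move=> u0 v0; rewrite !ler_norml => /andP[h1 h2].
by apply/andP; split; nra.
Qed.

Lemma absz_mean_sqrt N :
  `|Num.sqrt (pi / 2) * absz_mean R N - Num.sqrt N%:R| <= 1.
Proof.
apply: ler_dist_sqr; rewrite ?mulr_ge0 ?sqrtr_ge0 ?absz_mean_ge0//.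
rewrite exprMn !sqr_sqrtr ?ler0n ?divr_ge0 ?pi_ge0//.
exact: absz_mean_sqr.
Qed.

(** A binomial count has variance at most its mean $ms$, so its square root has bounded
    fluctuations; the bound obtained is $(1-s)/2+1/2$. *)
Lemma binE_sqrt (s : R) m : 0 < s <= 1 -> (0 < m)%N ->
  `|binE s m (fun k => Num.sqrt k%:R) - Num.sqrt (m%:R * s)| <= 1.
Proof.
move=> /andP[s0 s1] m0; set b := Num.sqrt (m%:R * s).
have ms0 : 0 < m%:R * s by rewrite mulr_gt0// ltr0n.
have b0 : 0 < b by rewrite sqrtr_gt0.
have s01 : 0 <= s <= 1 by rewrite ltW.
have -> : binE s m (fun k => Num.sqrt k%:R) - b =
    binE s m (fun k => Num.sqrt k%:R - b) by rewrite binED binE_cst.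
apply: (le_trans (ler_norm_binE _ _ s01)).
apply: (@le_trans _ _ (binE s m
    (fun k => (m%:R * s)^-1 / 2 * (k%:R - m%:R * s + 0) ^+ 2 + 2^-1))).
  apply: ler_binE => // k.
  (* AM-GM: [|sqrt k - b| <= |k - b^2| / b <= ((k - b^2)^2 / b^2 + 1) / 2] *)
  set a := Num.sqrt k%:R; have a0 : 0 <= a by exact: sqrtr_ge0.
  have -> : k%:R = a ^+ 2 :> R by rewrite sqr_sqrtr.
  have -> : m%:R * s = b ^+ 2 by rewrite sqr_sqrtr// ltW.
  set t := `|a - b|; have t0 : 0 <= t by exact: normr_ge0.
  have -> : (a ^+ 2 - b ^+ 2 + 0) ^+ 2 = t ^+ 2 * (a + b) ^+ 2.
    by rewrite /t real_normK ?num_real//; ring.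
  have h : t ^+ 2 * b ^+ 2 <= t ^+ 2 * (a + b) ^+ 2.
    rewrite ler_wpM2l ?sqr_ge0// lerXn2r ?nnegrE ?addr_ge0 ?lerDr ?(ltW b0)//.
  have h2 : t ^+ 2 <= (b ^+ 2)^-1 * (t ^+ 2 * (a + b) ^+ 2).
    by rewrite ler_pdivlMl ?exprn_gt0// mulrC.
  rewrite mulrAC; apply: (@le_trans _ _ ((t ^+ 2 + 1) / 2)); last first.
    by rewrite mulrDl div1r lerD2r ler_pM2r ?invr_gt0.
  have := sqr_ge0 (t - 1); lra.
rewrite binED binEZ binE_cst binE_var expr0n/= add0r.
have -> : (m%:R * s)^-1 / 2 * (m%:R * (s * (1 - s))) = (1 - s) / 2.
  by field; rewrite (gt_eqF s0) pnatr_eq0 -lt0n m0.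
lra.
Qed.

(** * The difference of two independent binomial variables *)

Section absdiff.
Variable p : R.

Definition diffE m (f : int -> R) (z : int) :=
  binE p m (fun k => binE p m (fun l => f (z + k%:Z - l%:Z))).

(** One more trial on each side: the outcomes agree with probability $1-2p(1-p)$ and cancel;
    otherwise the difference moves by $+1$ or $-1$ with equal probability. *)
Lemma diffES m f z : diffE m.+1 f z =
  (1 - p *+ 2 * (1 - p)) * diffE m f z + p *+ 2 * (1 - p) * diffE m (avg f) z.
Proof.
rewrite /diffE [LHS]/= /comp !binED !binEZ.
have -> : binE p m (fun k => binE p m (fun l => avg f (z + k%:Z - l%:Z))) =
   (binE p m (fun k => binE p m (fun l => f (z + k%:Z - l.+1%:Z)))
   + binE p m (fun k => binE p m (fun l => f (z + k.+1%:Z - l%:Z)))) / 2.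
  rewrite mulrC -binED -binEZ; apply: eq_binE => k.
  rewrite -binED -binEZ; apply: eq_binE => l.
  by rewrite /avg addrC mulrC; congr (_ * (f _ + f _)); lia.
have -> : binE p m (fun k => binE p m (fun l => f (z + k.+1%:Z - l.+1%:Z))) =
  binE p m (fun k => binE p m (fun l => f (z + k%:Z - l%:Z))).
  by apply: eq_binE => k; apply: eq_binE => l; congr f; lia.
by field.
Qed.

(* The difference of two binomial variables is a symmetric simple random walk
   run for a binomial number of steps. *)
Lemma diffE_avg m f z :
  diffE m f z = binE (p *+ 2 * (1 - p)) m (fun N => iter N (@avg R) f z).
Proof.
elim: m f => [|m IH] f; first by rewrite /diffE/= addr0 subr0.
by rewrite diffES !IH; congr (_ + _ * _); apply: eq_binE => N; rewrite /= -iterSr.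
Qed.

(** Replacing $\sqrt{\pi/2}\,a_N$ by $\sqrt N$, then the mean of $\sqrt N$ by $\sqrt{ms}$ with
    $s=2p(1-p)$, costs 1 each time; dividing by $w=\sqrt{\pi/2}\ge1$ keeps the total at most 2. *)
Lemma diffE_absz m : 0 < p < 1 -> (0 < m)%N ->
  `|diffE m (fun z => `|z|%N%:R) 0
    - 2 * Num.sqrt (p * (1 - p) / pi) * Num.sqrt m%:R| <= 2.
Proof.
move=> /andP[p0 p1] m0; rewrite diffE_avg -/(absz_mean _ _).
set s := p *+ 2 * (1 - p).
have s01 : 0 < s <= 1.
  rewrite /s mulr2n; apply/andP; split; last by nra.
  by rewrite mulr_gt0 ?subr_gt0// addr_gt0.
have s01' : 0 <= s <= 1 by case/andP: s01 => /ltW -> ->.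
pose w : R := Num.sqrt (pi / 2).
have pi0 := @pi_gt0 R.
have w1 : 1 <= w.
  by rewrite -[leLHS]sqrtr1 ler_sqrt ?divr_gt0//; have := @pi_ge2 R; lra.
have w0 : 0 < w by rewrite (lt_le_trans _ w1).
have E : 2 * Num.sqrt (p * (1 - p) / pi) * Num.sqrt m%:R = w^-1 * Num.sqrt (m%:R * s).
  apply: (mulfI (lt0r_neq0 w0)); rewrite mulVKf ?lt0r_neq0//.
  have -> : 2 = Num.sqrt (2 ^+ 2) :> R by rewrite sqrtr_sqr ger0_norm.
  have q0 : 0 <= p * (1 - p) by rewrite mulr_ge0 ?subr_ge0 ?ltW.
  have h4 : 0 <= 2 ^+ 2 :> R by exact: sqr_ge0.
  have h5 : 0 <= 2 ^+ 2 * (p * (1 - p) / pi) by rewrite mulr_ge0// divr_ge0// ltW.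
  have h6 : 0 <= pi / 2 :> R by rewrite divr_ge0// ltW.
  rewrite -(sqrtrM _ h4) -(sqrtrM _ h5) -(sqrtrM _ h6); congr Num.sqrt.
  by rewrite /s; move: (pi : R) (lt0r_neq0 pi0) => q q_neq0; field.
rewrite E.
set B := binE _ _ _.
have h : `|w * B - Num.sqrt (m%:R * s)| <= 2.
  rewrite -binEZ -[X in X - _](subrK (binE s m (fun k => Num.sqrt k%:R))).
  rewrite -addrA (le_trans (ler_normD _ _))// -[2]/(1 + 1) lerD ?binE_sqrt//.
  rewrite -mulN1r -binEZ -binED (le_trans (ler_norm_binE _ _ s01'))//.
  rewrite -[leRHS](binE_cst s m); apply: ler_binE => // k.
  by rewrite mulN1r absz_mean_sqrt.
rewrite -[B](mulKf (lt0r_neq0 w0)) -mulrBr normrM normfV (gtr0_norm w0).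
by rewrite ler_pdivrMl// (le_trans h)// ler_peMl.
Qed.
End absdiff.
End wallis.

(** * Multinomial expectations *)

Section multinomial_expectation.
Variables (R : realType) (d : nat).
Implicit Types (x : 'rV[R]_d) (k : {ffun 'I_d -> nat}).
Implicit Types (g h : {ffun 'I_d -> nat} -> R).

Definition incr k j : {ffun 'I_d -> nat} := [ffun i => (k i + (i == j))%N].
(** Truncated subtraction: a zero coordinate stays zero, hence the conditions [0 < k j] in what
    follows. *)
Definition decr k j : {ffun 'I_d -> nat} := [ffun i => (k i - (i == j))%N].

(* Mean of [g] under the multinomial law; the remaining probability
   [1 - \sum_j x_j] is that of a trial which increments no coordinate. *)
Fixpoint mulE x m g : R :=
  if m is m'.+1 then
    (1 - \sum_(j < d) x ord0 j) * mulE x m' g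
    + \sum_(j < d) x ord0 j * mulE x m' (fun k => g (incr k j))
  else g [ffun=> 0%N].

(** A trial increments at most one coordinate, so only multi-indices of sum at most [m] are
    evaluated: those whose grid points lie in the simplex. *)
Lemma eq_mulE_le x m g h : (forall k, (\sum_(j < d) k j <= m)%N -> g k = h k) ->
  mulE x m g = mulE x m h.
Proof.
elim: m g h => [|m IH] g h gh /=.
  by apply: gh; rewrite big1// => j _; rewrite ffunE.
rewrite (IH g h); last by move=> k km; apply: gh; rewrite (leq_trans km).
congr (_ + _); apply: eq_bigr => j _; congr (_ * _); apply: IH => k km.
apply: gh; rewrite (eq_bigr (fun i => k i + (i == j))%N); last first.
  by move=> i _; rewrite ffunE.
by rewrite big_split/= -big_mkcond/= big_pred1_eq addn1 ltnS.
Qed.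

Lemma eq_mulE x m g h : g =1 h -> mulE x m g = mulE x m h.
Proof. by move=> gh; apply: eq_mulE_le => k _; exact: gh. Qed.

Lemma mulE_linear x m a g h :
  mulE x m (fun k => a * g k + h k) = a * mulE x m g + mulE x m h.
Proof.
elim: m g h => [|m IH] g h //=; rewrite IH.
set s := 1 - \sum_(j < d) _; rewrite (eq_bigr (fun j => a * (x ord0 j * mulE x m (fun k => g (incr k j)))
    + x ord0 j * mulE x m (fun k => h (incr k j)))); last first.
  by move=> j _; have /= -> := IH (fun k => g (incr k j)) (fun k => h (incr k j)); ring.
by rewrite big_split/= -mulr_sumr; ring.
Qed.

Lemma mulE_cst x m a : mulE x m (fun=> a) = a.
Proof.
elim: m => [|m IH] //=; rewrite IH.
by rewrite -mulr_suml -mulrDl subrK mul1r.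
Qed.

Lemma mulED x m g h :
  mulE x m (fun k => g k + h k) = mulE x m g + mulE x m h.
Proof.
rewrite -[mulE x m g]mul1r -mulE_linear.
by apply: eq_mulE => k; rewrite mul1r.
Qed.

Lemma mulEZ x m a g : mulE x m (fun k => a * g k) = a * mulE x m g.
Proof.
rewrite -[RHS]addr0 -(mulE_cst x m 0) -mulE_linear.
by apply: eq_mulE => k; rewrite addr0.
Qed.

Lemma mulE_sum x m (I : Type) (s : seq I) (P : pred I)
    (G : I -> {ffun 'I_d -> nat} -> R) :
  mulE x m (fun k => \sum_(i <- s | P i) G i k) =
  \sum_(i <- s | P i) mulE x m (G i).
Proof.
elim: s => [|i s IH].
  rewrite big_nil (@eq_mulE _ _ _ (fun=> 0)) ?mulE_cst// => k; by rewrite big_nil.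
rewrite big_cons -IH; case: ifP => Pi; last first.
  by apply: eq_mulE => k; rewrite big_cons Pi.
by rewrite -mulED; apply: eq_mulE => k; rewrite big_cons Pi.
Qed.

(** Marginals are binomial: a trial that increments another coordinate, or none, counts as a
    failure. *)
Lemma mulE_coord x m (f : nat -> R) i :
  mulE x m (fun k => f (k i)) = binE (x ord0 i) m f.
Proof.
elim: m f => [|m IH] f /=; first by rewrite ffunE.
rewrite IH -[in RHS](IH (f \o succn)).
set s := 1 - \sum_(j < d) _; rewrite (bigD1 i)//=.
have -> : mulE x m (fun k => f (incr k i i)) =
    mulE x m (fun k => (f \o succn) (k i)).
  by apply: eq_mulE => k; rewrite ffunE eqxx addn1.
rewrite (eq_bigr (fun j => x ord0 j * binE (x ord0 i) m f)); last first.
  move=> j ji; rewrite -IH; congr (_ * _); apply: eq_mulE => k.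
  by rewrite ffunE eq_sym (negbTE ji) addn0.
by rewrite -mulr_suml /s (bigD1 i)//=; ring.
Qed.

Lemma mulE_cov x m a b i j :
  mulE x m (fun k => ((k i)%:R - m%:R * x ord0 i + a)
                     * ((k j)%:R - m%:R * x ord0 j + b)) =
  a * b + m%:R * ((i == j)%:R * x ord0 i - x ord0 i * x ord0 j).
Proof.
elim: m a b => [|m IH] a b /=; first by rewrite !ffunE; ring.
rewrite (@eq_mulE _ _ _ (fun k => ((k i)%:R - m%:R * x ord0 i + (a - x ord0 i))
  * ((k j)%:R - m%:R * x ord0 j + (b - x ord0 j)))); last first.
  by move=> k; rewrite -natr1; ring.
rewrite IH.
set c := m%:R * _.
have E l : mulE x m (fun k => ((incr k l i)%:R - m.+1%:R * x ord0 i + a) *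
    ((incr k l j)%:R - m.+1%:R * x ord0 j + b)) =
  (a - x ord0 i + (i == l)%:R) * (b - x ord0 j + (j == l)%:R) + c.
  rewrite -IH; apply: eq_mulE => k.
  by rewrite !ffunE !natrD -natr1; ring.
set s := 1 - \sum_(l < d) _; under eq_bigr do rewrite E.
rewrite (eq_bigr (fun l => ((a - x ord0 i) * (b - x ord0 j) + c) * x ord0 l
  + ((a - x ord0 i) * (x ord0 l * (j == l)%:R)
  + (b - x ord0 j + (j == i)%:R) * (x ord0 l * (i == l)%:R)))); last first.
  by move=> l _; case: (altP (i =P l)) => [->|_] /=; rewrite ?mulr1n ?mulr0n; ring.
have S1 n : \sum_(l < d) x ord0 l * (n == l)%:R = x ord0 n.
  under eq_bigr do rewrite mulr_natr mulrb eq_sym.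
  by rewrite -big_mkcond/= big_pred1_eq.
rewrite !big_split/= -!mulr_sumr !S1 eq_sym /s /c -natr1; ring.
Qed.

(** * Multinomial point probabilities and the Bernstein weights *)

Definition monomial_fact x k : R := \prod_(j < d) (x ord0 j ^+ k j / (k j)`!%:R).

Lemma monomial_fact_decr x k j : (0 < k j)%N ->
  x ord0 j * monomial_fact x (decr k j) = (k j)%:R * monomial_fact x k.
Proof.
move=> kj; rewrite /monomial_fact (bigD1 j)//= [in RHS](bigD1 j)//=.
rewrite ffunE eqxx subn1.
rewrite (eq_bigr (fun i => x ord0 i ^+ k i / (k i)`!%:R)); last first.
  by move=> i ij; rewrite ffunE (negbTE ij) subn0.
rewrite !mulrA; congr (_ * _); case: (k j) kj => // n _ /=.
rewrite exprS factS natrM invfM; field.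
by rewrite nat1r !pnatr_eq0 -lt0n fact_gt0.
Qed.

Definition multinom x m k : R :=
  if (\sum_(j < d) k j <= m)%N then
    m`!%:R * ((1 - \sum_(j < d) x ord0 j) ^+ (m - \sum_(j < d) k j) / (m - \sum_(j < d) k j)`!%:R)
    * monomial_fact x k
  else 0.

(** Up to a common term, a trial without increment contributes $m+1-s$ and one that increments
    coordinate $j$ contributes $k_j$, where $s=\sum_j k_j$; these factors add up to $m+1$. *)
Lemma multinomS x m k : multinom x m.+1 k =
  (1 - \sum_(j < d) x ord0 j) * multinom x m k
  + \sum_(j < d | (0 < k j)%N) x ord0 j * multinom x m (decr k j).
Proof.
set s := (\sum_(j < d) k j)%N.
have sD j : (0 < k j)%N -> (\sum_(i < d) decr k j i)%N = s.-1.
  move=> kj; rewrite /s (bigD1 j)//= [in RHS](bigD1 j)//= ffunE eqxx.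
  rewrite (eq_bigr k); last by move=> i ij; rewrite ffunE (negbTE ij) subn0.
  by move: kj; case: (k j) => // n _; rewrite subn1.
have s0 j : (0 < k j)%N -> (0 < s)%N.
  by move=> kj; rewrite (leq_trans kj)// /s (bigD1 j)//= leq_addr.
rewrite /multinom -/s; set t := 1 - \sum_(j < d) _; case: leqP => sm; last first.
  rewrite leqNgt (ltn_trans _ sm)//= mulr0 add0r big1// => j kj.
  by rewrite sD// leqNgt -ltnS prednK ?(s0 _ kj)// sm mulr0.
rewrite (eq_bigr (fun j => (k j)%:R * (m`!%:R * (t ^+ (m.+1 - s) /
  (m.+1 - s)`!%:R) * monomial_fact x k))); last first.
  move=> j kj; rewrite sD//; have sp := s0 _ kj.
  have -> : (s.-1 <= m)%N by lia.
  have -> : (m - s.-1 = m.+1 - s)%N by lia.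
  by rewrite mulrCA monomial_fact_decr// mulrCA.
rewrite -mulr_suml.
have -> : \sum_(j < d | (0 < k j)%N) (k j)%:R = s%:R :> R.
  by rewrite /s natr_sum [RHS](bigID (fun j => 0 < k j)%N)/= [X in _ + X]big1 ?addr0// =>
    j; rewrite -leqNgt leqn0 => /eqP ->.
set q := monomial_fact x k.
(* When $s=m+1$, the factor [(m.+1 - s)%:R] is 0 and matches the null value of [multinom]. *)
have -> : t * (if (s <= m)%N then m`!%:R * (t ^+ (m - s) / (m - s)`!%:R) * q else 0)
  = (m.+1 - s)%:R * (m`!%:R * (t ^+ (m.+1 - s) / (m.+1 - s)`!%:R) * q).
  case: leqP => [sm'|ms]; last first.
    by rewrite (_ : m.+1 - s = 0)%N ?mul0r ?mulr0//; lia.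
  rewrite subSn// factS natrM invfM exprS; field.
  by rewrite nat1r !pnatr_eq0 -lt0n fact_gt0.
rewrite -mulrDl -natrD subnK// factS natrM; ring.
Qed.

Lemma mulE_indic x m k0 : mulE x m (fun k => (k == k0)%:R) = multinom x m k0.
Proof.
elim: m k0 => [|m IH] k0 /=.
  rewrite /multinom leqn0; case: eqP => [<-|k00].
    rewrite big1 ?eqxx ?subnn ?expr0 ?divr1 ?mul1r; last by move=> j _; rewrite ffunE.
    by rewrite /monomial_fact big1// => j _; rewrite ffunE fact0 divr1.
  case: eqP => // /eqP; rewrite sum_nat_eq0 => /forallP H; case: k00.
  by apply/ffunP => j; rewrite ffunE; have /= /eqP -> := H j.
rewrite multinomS IH; congr (_ + _).
rewrite [RHS]big_mkcond; apply: eq_bigr => j _; case: ifPn => kj.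
  rewrite -IH; congr (_ * _); apply: eq_mulE => k; congr (nat_of_bool _)%:R.
  apply/eqP/eqP => [<-|->]; apply/ffunP => i; rewrite !ffunE; first by rewrite addnK.
  by case: eqP => [->|_]; rewrite ?subn0 ?addn0// subn1 addn1 prednK.
rewrite (@eq_mulE _ _ _ (fun=> 0)) ?mulE_cst ?mulr0// => k.
case: eqP => // E; move: kj; rewrite -E ffunE eqxx; lia.
Qed.

Definition natk m (k : {ffun 'I_d -> 'I_m.+1}) : {ffun 'I_d -> nat} :=
  [ffun j => nat_of_ord (k j)].

Lemma l1_nonneg_sum x : (forall j, 0 <= x ord0 j) -> l1 x = \sum_(j < d) x ord0 j.
Proof. by move=> x0; apply: eq_bigr => j _; rewrite ger0_norm. Qed.

Lemma bern_weightE x m (k : {ffun 'I_d -> 'I_m.+1}) :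
  (forall j, 0 <= x ord0 j) -> (ksum k <= m)%N ->
  bern_weight k x = multinom x m (natk k).
Proof.
move=> x0 km; rewrite /bern_weight /multinom l1_nonneg_sum//.
have -> : (\sum_(j < d) natk k j)%N = ksum k by apply: eq_bigr => j _; rewrite ffunE.
rewrite km /monomial_fact; set t := 1 - \sum_(j < d) _.
rewrite [in RHS](eq_bigr (fun j => x ord0 j ^+ k j / (k j)`!%:R)); last first.
  by move=> j _; rewrite ffunE.
by rewrite big_split/= prodfV invfM; ring.
Qed.

Lemma bern_weight_sum x m g : (forall j, 0 <= x ord0 j) ->
  \sum_(k : {ffun 'I_d -> 'I_m.+1} | (ksum k <= m)%N) g (natk k) * bern_weight k x
  = mulE x m g.
Proof.
move=> x0.
rewrite (eq_bigr (fun l : {ffun 'I_d -> 'I_m.+1} =>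
  mulE x m (fun k => g (natk l) * (k == natk l)%:R))); last first.
  by move=> k km; rewrite mulEZ mulE_indic bern_weightE.
(* After exchanging sum and mean, at each [k] a single indicator survives; its bounded index exists
   because the coordinates of [k] are at most [m]. *)
rewrite -mulE_sum; apply: eq_mulE_le => k km.
have km1 j : (k j < m.+1)%N.
  by rewrite ltnS (leq_trans _ km)// (bigD1 j)//= leq_addr.
pose k' : {ffun 'I_d -> 'I_m.+1} := [ffun j => Ordinal (km1 j)].
have kE : natk k' = k by apply/ffunP => j; rewrite !ffunE.
rewrite (bigD1 k')/=; last first.
  by rewrite (leq_trans _ km)//; apply: eq_leq; apply: eq_bigr => j _; rewrite /k' ffunE.
rewrite kE eqxx mulr1 big1 ?addr0// => l /andP[_ lk].
case: eqP => [E|_]; last by rewrite mulr0.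
case/eqP: lk; apply/ffunP => j; apply: val_inj.
by have := congr1 (fun k1 : {ffun 'I_d -> nat} => k1 j) (etrans kE E); rewrite !ffunE.
Qed.

Lemma ler_mulE x m g h : (forall j, 0 <= x ord0 j) -> \sum_(j < d) x ord0 j <= 1 ->
  (forall k, (\sum_(j < d) k j <= m)%N -> g k <= h k) -> mulE x m g <= mulE x m h.
Proof.
move=> x0 x1; elim: m g h => [|m IH] g h gh /=.
  by apply: gh; rewrite big1// => j _; rewrite ffunE.
apply: lerD.
  apply: ler_wpM2l; first by rewrite subr_ge0.
  by apply: IH => k km; apply: gh; rewrite (leq_trans km).
apply: ler_sum => j _; apply: ler_wpM2l => //; apply: IH => k km.
apply: gh; rewrite (eq_bigr (fun i => k i + (i == j))%N); last first.
  by move=> i _; rewrite ffunE.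
by rewrite big_split/= -big_mkcond/= big_pred1_eq addn1 ltnS.
Qed.

Lemma ler_norm_mulE x m g : (forall j, 0 <= x ord0 j) -> \sum_(j < d) x ord0 j <= 1 ->
  `|mulE x m g| <= mulE x m (fun k => `|g k|).
Proof.
move=> x0 x1; rewrite ler_norml -mulN1r -mulEZ; apply/andP; split.
  by apply: ler_mulE => // k _; rewrite mulN1r lerNl -normrN ler_norm.
by apply: ler_mulE => // k _; exact: ler_norm.
Qed.
End multinomial_expectation.

(** * Derivatives along lines *)

Section line_derivative.
Variables (R : realType) (V : normedModType R).
Implicit Types (f : V -> R) (v e u x : V).

Lemma is_derive_line f v e (t a : R) : is_derive (v + t *: e) e f a ->
  is_derive t (1 : R) (fun r => f (v + r *: e)) a.
Proof.
move=> [df dfE].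
have E : (fun h : R => h^-1 *: (((fun r => f (v + r *: e)) \o shift t) (h *: (1 : R))
      - f (v + t *: e))) =
    (fun h : R => h^-1 *: ((f \o shift (v + t *: e)) (h *: e) - f (v + t *: e))).
  apply/funext => h /=; congr (_ *: (f _ - _)).
  have -> : h *: (1 : R) = h by rewrite /GRing.scale/= mulr1.
  by rewrite scalerDl addrCA.
by split; [rewrite /derivable E|rewrite -dfE /derive E].
Qed.

Lemma MVT_dir f e : (forall y, derivable f y e) -> forall v (c : R),
  exists2 th : R, 0 <= th <= 1 &
    f (v + c *: e) - f v = c * 'D_e f (v + (th * c) *: e).
Proof.
move=> df v c.
have dg (t : R) : is_derive t (1 : R) ((fun r => f (v + r *: e)) \o (fun r => r * c))
    ('D_e f (v + (t * c) *: e) * c).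
  apply: is_derive1_comp.
    by apply: is_derive_line; apply: DeriveDef.
  have -> : (fun r : R => r * c) = c *: id by apply/funext => r; rewrite mulrC.
  by apply: is_derive_eq; rewrite /GRing.scale/= mulr1.
have [|t] := MVT_segment ler01 (fun t _ => dg t).
  by apply: derivable_within_continuous => t _; apply: ex_derive.
rewrite in_itv/= => t01 E; exists t => //.
by move: E; rewrite /= mul1r mul0r scale0r addr0 => ->; rewrite subr0 mulr1 mulrC.
Qed.

(** The step $h(u+ce)$ is split into $hu$ followed by $hce$. The mean value theorem turns the second
    part into $hc$ times the derivative along $e$ at a point [eta h] tending to [x]. Adding
    coordinates one at a time, continuous partial derivatives then yield every directional
    derivative. *)
Lemma is_derive_add_dir f x u e (a c : R) : (forall y, derivable f y e) ->
  {for x, continuous ('D_e f)} -> is_derive x u f a ->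
  is_derive x (u + c *: e) f (a + c * 'D_e f x).
Proof.
move=> df ce [du duE].
have /choice [th thP] (t : R) : exists th : R, 0 <= th <= 1 /\
   f ((t *: u + x) + (t * c) *: e) - f (t *: u + x) =
   t * c * 'D_e f ((t *: u + x) + (th * (t * c)) *: e).
  by have [th] := MVT_dir df (t *: u + x) (t * c); exists th.
pose eta t := (t *: u + x) + (th t * (t * c)) *: e.
have eta_cvg : eta t @[t --> 0^'] --> x.
  apply/cvgrPdist_lt => eps eps0.
  have M0 : 0 < `|u| + `|c| * `|e| + 1 by rewrite ltr_wpDl// addr_ge0// mulr_ge0.
  near=> t.
  have [/andP[t0 t1] _] := thP t.
  rewrite /eta -addrA addrCA opprD addNKr normrN.
  rewrite (le_lt_trans (ler_normD _ _))// !normrZ (ger0_norm t0).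
  apply: (@le_lt_trans _ _ (`|t| * (`|u| + `|c| * `|e| + 1))).
    have -> : `|t| * (`|u| + `|c| * `|e| + 1) =
      `|t| * `|u| + (`|t| * `|c| * `|e| + `|t|) by ring.
    by rewrite lerD2l ler_wpDr// ler_wpM2r// ler_piMl// mulr_ge0.
  rewrite -ltr_pdivlMr//; near: t.
  by apply: dnbhs0_lt; rewrite divr_gt0.
have H : (fun h : R => h^-1 *: ((f \o shift x) (h *: (u + c *: e)) - f x)) @ 0^'
    --> a + c * 'D_e f x.
  have : (fun h : R => h^-1 *: ((f \o shift x) (h *: u) - f x)
      + c * 'D_e f (eta h)) @ 0^' --> a + c * 'D_e f x.
    apply: cvgD; first by rewrite -duE; exact: du.
    by apply: cvgM; [exact: cvg_cst|exact: (cvg_comp _ _ eta_cvg ce)].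
  apply: cvg_trans; apply: near_eq_cvg; near=> h.
  have h0 : h != 0 by near: h; exact: nbhs_dnbhs_neq.
  have [_ hE] := thP h.
  have -> : (f \o shift x) (h *: (u + c *: e)) - f x =
      (f ((h *: u + x) + (h * c) *: e) - f (h *: u + x)) + (f (h *: u + x) - f x).
    by rewrite /= scalerDr scalerA addrAC addrA subrK.
  rewrite hE -/(eta h) [RHS]scalerDr [RHS]addrC; congr (_ + _).
  by rewrite -mulrA -[RHS]/(h^-1 * _) mulKf.
by split; [apply/cvg_ex; eexists; exact: H|exact: cvg_lim H].
Unshelve. all: by end_near. Qed.
End line_derivative.

(** * Taylor expansion on the unit cube *)

Section taylor.
Variables (R : realType).

(** The mean value theorem is used twice, on $g$ minus its linear and quadratic Taylor terms, then
    on $g_1$; the first intermediate point only contributes a factor in $[0,1]$. *)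
Lemma taylor2_line (g g1 g2 : R -> R) :
  (forall t, is_derive t (1 : R) g (g1 t)) ->
  (forall t, is_derive t (1 : R) g1 (g2 t)) ->
  exists2 s, 0 <= s <= 1 &
    `|g 1 - g 0 - g1 0 - 2^-1 * g2 0| <= `|g2 s - g2 0|.
Proof.
move=> dg dg1.
have dpsi (t : R) : is_derive t (1 : R)
    (g - (g1 0 *: id + (2^-1 * g2 0) *: (id ^+ 2))) (g1 t - (g1 0 + t * g2 0)).
  apply: is_derive_eq; rewrite /GRing.scale/= !mulr1 expr1.
  by congr (_ - (_ + _)); rewrite mulr2n; field.
have [|th] := MVT_segment ler01 (fun t _ => dpsi t).
  by apply: derivable_within_continuous => t _; apply: ex_derive.
rewrite in_itv/= => /andP[th0 th1] E.
have [|s] := MVT_segment th0 (fun t _ => dg1 t).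
  by apply: derivable_within_continuous => t _; apply: ex_derive.
rewrite in_itv/= => /andP[s0 sth] E1.
exists s; first by rewrite s0 (le_trans sth).
have -> : g 1 - g 0 - g1 0 - 2^-1 * g2 0 = th * (g2 s - g2 0).
  by move: E E1; rewrite !fctE /GRing.scale/= expr0n/= expr1n => E E1; lra.
by rewrite normrM ger0_norm// ler_piMl.
Qed.

Variable d : nat.
Implicit Types (f G : 'rV[R]_d -> R) (x y h : 'rV[R]_d).

Lemma is_derive_rV f :
  (forall i, (forall x, derivable f x (ebasis R i)) /\ continuous (partial i f)) ->
  forall x h, is_derive x h f (\sum_(i < d) h ord0 i * partial i f x).
Proof.
move=> f1 x h; rewrite {1}(row_sum_delta h).
elim/big_rec2: _ => [|i a u _ IH]; first exact: is_derive0.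
rewrite addrC [X in is_derive _ _ _ X]addrC.
have [df cf] := f1 i.
exact: (is_derive_add_dir (h ord0 i) df (cf x) IH).
Qed.

Definition hess G x h : R :=
  \sum_(i < d) \sum_(j < d) h ord0 i * h ord0 j * partial j (partial i G) x.

Lemma taylor2_rV G : C2 G -> forall x h, exists2 s : R, 0 <= s <= 1 &
  `|G (x + h) - G x - \sum_(i < d) h ord0 i * partial i G x - 2^-1 * hess G x h|
   <= `|hess G (x + s *: h) h - hess G x h|.
Proof.
move=> [_ G2] x h.
have dg (t : R) : is_derive t (1 : R) (fun r : R => G (x + r *: h))
    (\sum_(i < d) h ord0 i * partial i G (x + t *: h)).
  apply: is_derive_line; apply: is_derive_rV => i.
  by have [? []] := G2 i.
have dg1 (t : R) : is_derive t (1 : R)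
   (fun r : R => \sum_(i < d) h ord0 i * partial i G (x + r *: h))
   (hess G (x + t *: h) h).
  have dgi (i : 'I_d) : is_derive t (1 : R)
     (h ord0 i *: (fun r : R => partial i G (x + r *: h)))
     (h ord0 i *: (\sum_(j < d) h ord0 j * partial j (partial i G) (x + t *: h))).
    apply: is_deriveZ; apply: is_derive_line; apply: is_derive_rV => j.
    by have [_ [_ /(_ j)]] := G2 i.
  have : is_derive t (1 : R)
    (\sum_(i < d) h ord0 i *: (fun r : R => partial i G (x + r *: h)))
    (\sum_(i < d) h ord0 i *:
       (\sum_(j < d) h ord0 j * partial j (partial i G) (x + t *: h))).
    exact: is_derive_sum.
  have -> : \sum_(i < d) h ord0 i *: (fun r : R => partial i G (x + r *: h))
    = (fun r : R => \sum_(i < d) h ord0 i * partial i G (x + r *: h)).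
    by apply/funext => r; rewrite fct_sumE.
  move=> H; apply: is_derive_eq; apply: eq_bigr => i _.
  by rewrite scaler_sumr; apply: eq_bigr => j _; rewrite -[LHS]/(_ * _) mulrA.
have [s s01] := taylor2_line dg dg1.
by rewrite scale1r scale0r addr0 => H; exists s; [exact: s01|exact: H].
Qed.

(** The cube is convex, and compact as a product of segments; it contains the simplex, and [G] is
    smooth on the whole space. *)
Definition inbox x : Prop := forall j, 0 <= x ord0 j <= 1.

Lemma compact_inbox : compact inbox.
Proof.
have -> : inbox = [set v : 'rV[R]_d | forall i, `[0%R, 1%R]%classic (v ord0 i)].
  by apply/seteqP; split => v /= H j; have := H j; rewrite ?in_itv.
have H := @rV_compact R d (fun=> `[0%R, 1%R]%classic) (fun=> @segment_compact R 0 1).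
exact: H.
Qed.

Lemma bounded_inbox f : continuous f ->
  exists2 M, 0 <= M & forall x, inbox x -> `|f x| <= M.
Proof.
move=> cf.
have /compact_bounded [M [_ HM]] : compact [set f x | x in inbox].
  apply: continuous_compact; last exact: compact_inbox.
  exact: continuous_subspaceT.
exists (`|M| + 1); first by rewrite addr_ge0.
move=> x xb; apply: (HM (`|M| + 1)); last by exists x.
by rewrite ltr_pwDr// ler_norm.
Qed.

Definition sqdist x y : R := \sum_(i < d) (y ord0 i - x ord0 i) ^+ 2.

Lemma sqdist_ge0 x y : 0 <= sqdist x y.
Proof. by apply: sumr_ge0 => i _; exact: sqr_ge0. Qed.

(** Uniform continuity handles points closer than [delta]; for the others, $2M$ is at most
    $2M/\delta^2$ times the squared distance. A modulus of this quadratic form can be averaged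
    against moments. *)
Lemma modulus_inbox f (eps : R) : continuous f -> 0 < eps ->
  exists2 C, 0 <= C & forall x y, inbox x -> inbox y ->
    `|f y - f x| <= eps + C * sqdist x y.
Proof.
move=> cf eps0; have [M M0 HM] := bounded_inbox cf.
have [delta delta0 Hd] : exists2 delta : R, 0 < delta & forall x y, inbox x ->
    ball x delta y -> `|f y - f x| <= eps.
  (* Compactness as near-covering: radii valid locally around each point yield one radius for the
     whole cube. *)
  have /compact_near_coveringP := compact_inbox.
  move=> /(_ R (0^'+) (fun delta x => forall y, ball x delta y -> `|f y - f x| <= eps)).
  case=> [x _|e /= e0 He].
    have /cvgrPdist_lt /(_ (eps / 2)) := cf x.
    rewrite divr_gt0// => /(_ isT) /nbhs_ballP [r /= r0 Hr].
    exists (ball x (r / 2), [set t | t < r / 2]) => /=.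
      split; first by apply: nbhsx_ballx; rewrite divr_gt0.
      by apply: nbhs_right_lt; rewrite divr_gt0.
    move=> [z t] /= [xz tr] y zy.
    have xr : ball x r z by apply: le_ball xz; rewrite ler_pdivrMr// ler_pMr// ler1n.
    have yr : ball x r y.
      apply: (@ball_split _ _ z) => //; apply: le_ball zy; exact: ltW.
    have := Hr _ xr; have := Hr _ yr => /= h1 h2.
    have -> : f y - f z = (f x - f z) - (f x - f y) by ring.
    by rewrite (le_trans (ler_normB _ _))// [leRHS]splitr lerD// ltW.
  exists (e / 2); first by rewrite divr_gt0.
  move=> x y xb; apply: He => //=; last by rewrite divr_gt0.
  by rewrite /ball/= sub0r normrN gtr0_norm ?divr_gt0// ltr_pdivrMr// ltr_pMr// ltr1n.
exists (2 * M / delta ^+ 2); first by rewrite divr_ge0 ?exprn_ge0 ?mulr_ge0// ltW.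
move=> x y xb yb; have [xy|xy] := pselect (ball x delta y).
  by rewrite ler_wpDr ?Hd// mulr_ge0 ?sqdist_ge0// divr_ge0 ?exprn_ge0 ?mulr_ge0// ltW.
have [j xyj] : exists j : 'I_d, delta <= `|x ord0 j - y ord0 j|.
  apply: contrapT => /forallNP H; apply: xy; split => // i j.
  by rewrite (ord1 i) /ball/= ltNge; apply/negP; exact: H.
rewrite ler_wpDl ?(ltW eps0)// (@le_trans _ _ (2 * M))//.
  by rewrite (le_trans (ler_normB _ _))// mulr2n mulrDl mul1r lerD// HM.
rewrite -mulrA ler_peMr ?mulr_ge0// mulrC ler_pdivlMr ?exprn_gt0// mul1r.
rewrite /sqdist (bigD1 j)//=.
apply: (@le_trans _ _ ((y ord0 j - x ord0 j) ^+ 2)); last first.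
  by rewrite lerDl sumr_ge0// => i _; exact: sqr_ge0.
rewrite -[leRHS]real_normK ?num_real// distrC.
by rewrite lerXn2r ?nnegrE ?(ltW delta0).
Qed.

Lemma sum_norm_mul_le h : \sum_(i < d) \sum_(j < d) `|h ord0 i * h ord0 j| <=
  d%:R * \sum_(i < d) h ord0 i ^+ 2.
Proof.
apply: (@le_trans _ _ (\sum_(i < d) \sum_(j < d)
    (h ord0 i ^+ 2 / 2 + h ord0 j ^+ 2 / 2))).
  apply: ler_sum => i _; apply: ler_sum => j _.
  rewrite normrM -(real_normK (num_real (h ord0 i))).
  rewrite -(real_normK (num_real (h ord0 j))).
  have := sqr_ge0 (`|h ord0 i| - `|h ord0 j|); lra.
under eq_bigr do rewrite big_split/= sumr_const card_ord.
rewrite big_split/= sumr_const card_ord sumrMnl -!mulr_suml -mulr_natl.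
by rewrite le_eqVlt; apply/orP; left; apply/eqP; rewrite -mulr_natl; field.
Qed.

Lemma inbox_segment x y (s : R) : inbox x -> inbox y -> 0 <= s <= 1 ->
  inbox (x + s *: (y - x)).
Proof.
move=> xb yb /andP[s0 s1] j; rewrite !mxE.
have /andP[x0 x1] := xb j; have /andP[y0 y1] := yb j.
by apply/andP; split; nra.
Qed.

Lemma taylor2_inbox G (eps : R) : C2 G -> 0 < eps ->
  exists2 C, 0 <= C & forall x y, inbox x -> inbox y ->
  `|G y - G x - \sum_(i < d) (y ord0 i - x ord0 i) * partial i G x
    - 2^-1 * hess G x (y - x)| <= eps * sqdist x y + C * sqdist x y ^+ 2.
Proof.
move=> G2 eps0.
(* [sum_norm_mul_le] costs a factor [d], which [d.+1] absorbs while staying nonzero. *)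
pose e := eps / d.+1%:R.
have e0 : 0 < e by rewrite divr_gt0.
have /choice [C0 C0P] (ij : 'I_d * 'I_d) : exists C, 0 <= C /\ forall x y, inbox x -> inbox y ->
    `|partial ij.2 (partial ij.1 G) y - partial ij.2 (partial ij.1 G) x|
     <= e + C * sqdist x y.
  have [|C ? ?] := @modulus_inbox (partial ij.2 (partial ij.1 G)) e _ e0.
    by have [_ /(_ ij.1) [_ [_ /(_ ij.2) []]]] := G2.
  by exists C.
pose C := \sum_ij C0 ij.
have CP ij : C0 ij <= C.
  by rewrite /C (bigD1 ij)//= lerDl sumr_ge0// => k _; have [] := C0P k.
have C_ge0 : 0 <= C by apply: sumr_ge0 => ij _; have [] := C0P ij.
exists (d%:R * C); first by rewrite mulr_ge0.
move=> x y xb yb.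
have [s s01] := taylor2_rV G2 x (y - x).
rewrite [in G (x + _)]addrC subrK.
under [X in `|_ - X - _|]eq_bigr do rewrite !mxE.
move/le_trans; apply.
rewrite /hess -sumrB (le_trans (ler_norm_sum _ _ _))//.
have zb := inbox_segment xb yb s01.
apply: (@le_trans _ _ (\sum_(i < d) \sum_(j < d)
   `|(y - x) ord0 i * (y - x) ord0 j| * (e + C * sqdist x y))).
  apply: ler_sum => i _; rewrite -sumrB (le_trans (ler_norm_sum _ _ _))//.
  apply: ler_sum => j _; rewrite -mulrBr normrM ler_wpM2l//.
  have [_ /(_ _ _ xb zb)/= /le_trans] := C0P (i, j); apply.
  rewrite lerD2l ler_pM ?sqdist_ge0//; first by have [] := C0P (i, j).
  apply: ler_sum => k _; rewrite !mxE [X in X ^+ 2]addrAC subrr add0r.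
  rewrite exprMn ler_piMl ?sqr_ge0//.
  by case/andP: s01 => s0 s1; rewrite expr_le1.
under eq_bigr do rewrite -mulr_suml.
rewrite -mulr_suml.
have Q0 := sqdist_ge0 x y.
have := sum_norm_mul_le (y - x).
have -> : \sum_(i < d) (y - x) ord0 i ^+ 2 = sqdist x y.
  by apply: eq_bigr => i _; rewrite !mxE.
move=> /(ler_wpM2r (addr_ge0 (ltW e0) (mulr_ge0 C_ge0 Q0))) /le_trans; apply.
rewrite mulrDr expr2; apply: lerD; last by rewrite le_eqVlt; apply/orP; left; apply/eqP; ring.
rewrite mulrAC ler_wpM2r// /e mulrCA ler_piMr ?(ltW eps0)//.
by rewrite ler_pdivrMr// mul1r ler_nat.
Qed.

(** The second-order bound with [eps = 1], plus a bound on the second derivatives; on the cube the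
    squared distance is at most [d], which absorbs its square. *)
Lemma taylor1_inbox G : C2 G ->
  exists2 C, 0 <= C & forall x y, inbox x -> inbox y ->
  `|G y - G x - \sum_(i < d) (y ord0 i - x ord0 i) * partial i G x|
   <= C * sqdist x y.
Proof.
move=> G2; have [C C0 CP] := taylor2_inbox G2 ltr01.
have /choice [B0 B0P] (ij : 'I_d * 'I_d) : exists M, 0 <= M /\ forall x, inbox x ->
    `|partial ij.2 (partial ij.1 G) x| <= M.
  have [|M ? ?] := @bounded_inbox (partial ij.2 (partial ij.1 G)).
    by have [_ /(_ ij.1) [_ [_ /(_ ij.2) []]]] := G2.
  by exists M.
pose B := \sum_ij B0 ij.
have BP ij : B0 ij <= B.
  by rewrite /B (bigD1 ij)//= lerDl sumr_ge0// => k _; have [] := B0P k.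
have B_ge0 : 0 <= B by apply: sumr_ge0 => ij _; have [] := B0P ij.
exists (1 + C * d%:R + 2^-1 * (d%:R * B)).
  by rewrite !addr_ge0 ?mulr_ge0.
move=> x y xb yb.
rewrite -[X in `|X|](subrK (2^-1 * hess G x (y - x))).
rewrite (le_trans (ler_normD _ _))// mulrDl; apply: lerD.
  rewrite (le_trans (CP _ _ xb yb))// mulrDl lerD2l -mulrA ler_wpM2l//.
  rewrite expr2 ler_wpM2r ?sqdist_ge0//.
  rewrite -[leRHS](_ : \sum_(i < d) 1 = _); last by rewrite sumr_const card_ord.
  apply: ler_sum => i _; have /andP[? ?] := xb i; have /andP[? ?] := yb i; nra.
rewrite normrM ger0_norm// -mulrA ler_wpM2l// (le_trans (ler_norm_sum _ _ _))//.
apply: (@le_trans _ _ (\sum_(i < d) \sum_(j < d)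
   `|(y - x) ord0 i * (y - x) ord0 j| * B)).
  apply: ler_sum => i _; rewrite (le_trans (ler_norm_sum _ _ _))//.
  apply: ler_sum => j _; rewrite normrM ler_wpM2l//.
  by have [_ /(_ _ xb)/= /le_trans] := B0P (i, j); apply.
under eq_bigr do rewrite -mulr_suml.
rewrite -mulr_suml mulrAC ler_wpM2r//.
apply: (le_trans (sum_norm_mul_le _)); rewrite ler_wpM2l//.
by apply: ler_sum => i _; rewrite !mxE.
Qed.
End taylor.

(** * Moments of the estimator *)

Section indicator_combinations.
Context {dT : measure_display} {T : measurableType dT} {R : realType}.
Variable (P : probability T R).

Lemma integrable_indic_sum (I : Type) (s : seq I) (c : I -> R) (A : I -> set T) :
  (forall i, measurable (A i)) ->
  P.-integrable setT (fun w => \sum_(i <- s) ((c i)%:E * (\1_(A i) w)%:E)%E).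
Proof.
move=> mA; apply: integrable_sum => // i _; apply: integrableZl => //.
exact: integrable_indic.
Qed.

Lemma expectation_indic_sum (I : Type) (s : seq I) (c : I -> R) (A : I -> set T) :
  (forall i, measurable (A i)) ->
  (fun w => \sum_(i <- s) c i * \1_(A i) w) \in Lfun P 1 /\
  ('E_P[fun w => (\sum_(i <- s) c i * \1_(A i) w)%R] =
    (\sum_(i <- s) c i * fine (P (A i)))%R%:E)%E.
Proof.
move=> mA.
have E : EFin \o (fun w => \sum_(i <- s) c i * \1_(A i) w) =
    fun w => (\sum_(i <- s) ((c i)%:E * (\1_(A i) w)%:E)%E).
  by apply/funext => w /=; rewrite sumEFin.
split; first by apply/Lfun1_integrable; rewrite E; exact: integrable_indic_sum.
rewrite unlock -[X in (\int[P]_w X w)%E]/(EFin \o _) E integral_sum//; last first.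
  by move=> i; apply: integrableZl => //; exact: integrable_indic.
rewrite -sumEFin; apply: eq_bigr => i _.
rewrite integralZl//; last exact: integrable_indic.
by rewrite integral_indic// setIT EFinM fineK// fin_num_measure.
Qed.

(** The square is again a combination of indicators, those of the pairwise intersections. *)
Lemma variance_indic_sum (I : finType) (c : I -> R) (A : I -> set T) :
  (forall i, measurable (A i)) ->
  ('V_P[fun w => (\sum_i c i * \1_(A i) w)%R] =
    (\sum_i \sum_j c i * c j * fine (P (A i `&` A j))
      - (\sum_i c i * fine (P (A i))) ^+ 2)%R%:E)%E.
Proof.
move=> mA; set Z := fun w => _.
have [L1Z EZ] := expectation_indic_sum (index_enum I) c mA.
have mAA (ij : I * I) : measurable (A ij.1 `&` A ij.2) by exact: measurableI.
have [L1Z2 EZ2] := expectation_indic_sum (index_enum (I * I)%type)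
   (fun ij => c ij.1 * c ij.2) mAA.
have ZZ : (Z * Z)%R =
    fun w => \sum_ij c ij.1 * c ij.2 * \1_(A ij.1 `&` A ij.2) w.
  apply/funext => w; rewrite /GRing.mul/= /Z big_distrlr/= pair_big/=.
  by apply: eq_bigr => ij _; rewrite indicI mulrACA.
rewrite /variance covarianceE//; last by rewrite ZZ.
rewrite ZZ EZ2 EZ -EFinM -EFinB expr2 pair_big/=.
by [].
Qed.
End indicator_combinations.

Section bernstein_moments.
Context {dT : measure_display} {T : measurableType dT} {R : realType}.
Variables (P : probability T R) (d : nat).
Variables (X : nat -> T -> 'rV[R]_d) (F : 'rV[R]_d -> R).
Hypothesis mX : forall i (j : 'I_d), measurable_fun setT (fun w => X i w ord0 j).
Hypothesis indX : mutually_independent P X.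
Hypothesis cdfX : forall i y, P [set w | le_vec (X i w) y] = (F y)%:E.

Let A i y : set T := [set w | le_vec (X i w) y].

Lemma measurable_le_vec i y : measurable (A i y).
Proof.
have -> : A i y = \bigcap_(j in [set: 'I_d]) [set w | X i w ord0 j <= y ord0 j].
  by apply/seteqP; split => w /=; [move=> /forallP H j _; exact: H|
    move=> H; apply/forallP => j; exact: H].
apply: fin_bigcap_measurable => [|j _]; first exact: finite_finset.
have := mX i j measurableT (measurable_itv `]-oo, y ord0 j]).
by rewrite setTI; congr (measurable _); apply/seteqP; split => w /=; rewrite in_itv.
Qed.

Definition minvec (x y : 'rV[R]_d) : 'rV[R]_d :=
  \row_j Num.min (x ord0 j) (y ord0 j).

(** The minimum enters here: one observation lies below two points exactly when it lies below their
    componentwise minimum. Distinct observations factorise. *)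
Lemma prob_le_vecI i y i' y' : fine (P (A i y `&` A i' y')) =
  if i == i' then F (minvec y y') else F y * F y'.
Proof.
case: eqVneq => [<-|ii'].
  have -> : A i y `&` A i y' = A i (minvec y y').
    apply/seteqP; split => w /=.
      move=> [/forallP H /forallP H']; apply/forallP => j.
      by rewrite mxE le_min H H'.
    move=> /forallP H; split; apply/forallP => j; have := H j; rewrite mxE le_min;
      by case/andP.
  by rewrite cdfX.
have := @indX [:: i; i'] (fun k => [set z | le_vec z (if k == i then y else y')]).
have -> : \bigcap_(k in [set` [:: i; i']]) (X k @^-1`
    [set z | le_vec z (if k == i then y else y')]) = A i y `&` A i' y'.
  rewrite bigcap_seq !big_cons big_nil setIT /A eqxx.
  by rewrite eq_sym (negbTE ii').
rewrite !big_cons big_nil eqxx eq_sym (negbTE ii') mule1.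
rewrite -[_ @^-1` _]/(A i y) -[X in (_ * P X)%E]/(A i' y') !cdfX => -> //.
  by rewrite /= inE ii'.
move=> k; apply: sub_sigma_algebra.
exists (fun j => `]-oo, (if k == i then y else y') ord0 j]%classic).
split; first by move=> j; exact: measurable_itv.
apply/seteqP; split => z /=.
  by move=> /forallP H j; rewrite in_itv/=; exact: H.
by move=> H; apply/forallP => j; have := H j; rewrite in_itv.
Qed.

Variables (n m : nat).
Hypothesis n_gt0 : (0 < n)%N.
Variable x : 'rV[R]_d.

Let w (k : {ffun 'I_d -> 'I_m.+1}) := if (ksum k <= m)%N then bern_weight k x else 0.

Lemma bernstein_cdf_indic : bernstein_cdf X n m x =
  fun z => \sum_(ik : 'I_n * {ffun 'I_d -> 'I_m.+1})
    n%:R^-1 * w ik.2 * \1_(A ik.1 (kpoint R ik.2)) z.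
Proof.
apply/funext => z; rewrite /bernstein_cdf big_mkcond/=.
rewrite -(pair_big xpredT xpredT (fun i k =>
  n%:R^-1 * w k * \1_(A (nat_of_ord i) (kpoint R k)) z))/=.
rewrite exchange_big/=; apply: eq_bigr => k _.
rewrite /w; case: ifP => _; last by rewrite big1// => i _; rewrite mulr0 mul0r.
rewrite /ecdf mulr_sumr mulr_suml; apply: eq_bigr => i _.
rewrite mulrAC; congr (_ * _); rewrite indicE; congr (nat_of_bool _)%:R.
by apply/idP/idP; rewrite inE.
Qed.

Lemma bernstein_cdf_mean : ('E_P[bernstein_cdf X n m x] =
  (\sum_(k : {ffun 'I_d -> 'I_m.+1} | (ksum k <= m)%N)
     F (kpoint R k) * bern_weight k x)%R%:E)%E.
Proof.
rewrite bernstein_cdf_indic.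
have [|_ ->] := expectation_indic_sum P (index_enum ('I_n * {ffun 'I_d -> 'I_m.+1})%type)
   (fun ik => n%:R^-1 * w ik.2) (A := fun ik => A ik.1 (kpoint R ik.2)).
  by move=> ik; exact: measurable_le_vec.
congr (_ %:E); rewrite -(pair_big xpredT xpredT (fun i k =>
  n%:R^-1 * w k * fine (P (A (nat_of_ord i) (kpoint R k)))))/=.
rewrite exchange_big [RHS]big_mkcond/=; apply: eq_bigr => k _.
under eq_bigr do rewrite cdfX/=.
rewrite sumr_const card_ord -[LHS]mulr_natl /w; case: ifP => _; last by rewrite mulr0 mul0r mulr0.
by field; rewrite pnatr_eq0 -lt0n.
Qed.

Lemma bernstein_cdf_variance : ('V_P[bernstein_cdf X n m x] =
  (n%:R^-1 * (\sum_(k : {ffun 'I_d -> 'I_m.+1} | (ksum k <= m)%N)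
     (\sum_(l : {ffun 'I_d -> 'I_m.+1} | (ksum l <= m)%N)
       F (minvec (kpoint R k) (kpoint R l)) * bern_weight l x) * bern_weight k x
     - (\sum_(k : {ffun 'I_d -> 'I_m.+1} | (ksum k <= m)%N)
     F (kpoint R k) * bern_weight k x) ^+ 2))%R%:E)%E.
Proof.
set B := \sum_(k | _) (\sum_(l | _) _) * _; set M := \sum_(k | _) (F _ * _).
have BE : B = \sum_k \sum_l w k * w l * F (minvec (kpoint R k) (kpoint R l)).
  rewrite /B big_mkcond/=; apply: eq_bigr => k _; rewrite /w.
  case: ifP => _; last by rewrite big1// => l _; rewrite !mul0r.
  rewrite big_mkcond/= mulr_suml; apply: eq_bigr => l _.
  by case: ifP => _; ring.
have ME : M = \sum_k w k * F (kpoint R k).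
  rewrite /M big_mkcond/=; apply: eq_bigr => k _; rewrite /w.
  by case: ifP => _; ring.
have n0 : n%:R != 0 :> R by rewrite pnatr_eq0 -lt0n.
rewrite bernstein_cdf_indic variance_indic_sum; last first.
  by move=> ik; exact: measurable_le_vec.
congr (_ %:E).
rewrite (_ : \sum_ik _ * fine (P (A _ _)) = M); last first.
  rewrite ME -(pair_big xpredT xpredT (fun (i : 'I_n) k =>
    n%:R^-1 * w k * fine (P (A i (kpoint R k)))))/= exchange_big/=.
  apply: eq_bigr => k _; under eq_bigr do rewrite cdfX/=.
  by rewrite sumr_const card_ord -[LHS]mulr_natl; field.
rewrite -(pair_big xpredT xpredT (fun (i : 'I_n) k => \sum_(jl : 'I_n * {ffun 'I_d -> 'I_m.+1})
    n%:R^-1 * w k * (n%:R^-1 * w jl.2) *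
    fine (P (A i (kpoint R k) `&` A jl.1 (kpoint R jl.2)))))/=.
(* For fixed [i], the term $j=i$ gives [B] and the $n-1$ others give [M ^+ 2] each; summing over [i]
   and subtracting [M ^+ 2] leaves $(B-M^2)/n$. *)
rewrite (eq_bigr (fun=> n%:R^-1 ^+ 2 * (B + (n%:R - 1) * M ^+ 2))); last first.
  move=> i _.
  under eq_bigr => k _.
    rewrite -(pair_big xpredT xpredT (fun (j : 'I_n) l =>
      n%:R^-1 * w k * (n%:R^-1 * w l) *
      fine (P (A i (kpoint R k) `&` A j (kpoint R l)))))/=.
    over.
  rewrite exchange_big (bigD1 i)//= mulrDr; congr (_ + _).
    rewrite BE mulr_sumr; apply: eq_bigr => k _.
    rewrite mulr_sumr; apply: eq_bigr => l _.
    by rewrite prob_le_vecI eqxx; ring.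
  rewrite (eq_bigr (fun=> n%:R^-1 ^+ 2 * M ^+ 2)); last first.
    move=> j ji; rewrite ME (expr2 (\sum_k _)) big_distrlr/= mulr_sumr; apply: eq_bigr => k _.
    rewrite mulr_sumr; apply: eq_bigr => l _.
    rewrite prob_le_vecI ifF; last by rewrite eq_sym; exact: negbTE ji.
    ring.
  rewrite sumr_const cardC1 card_ord -[LHS]mulr_natl mulrCA; congr (_ * (_ * _)).
  by rewrite -subn1 natrB.
rewrite sumr_const card_ord -[X in X - _]mulr_natl; field.
exact: n0.
Qed.
End bernstein_moments.

(** * Asymptotic expansions *)

Lemma binE_mean (R : realType) (p : R) m c :
  binE p m (fun k => k%:R - m%:R * p + c) = c.
Proof.
elim: m c => [|m IH] c /=; first by ring.
rewrite (@eq_binE _ _ _ _ (fun k => k%:R - m%:R * p + (c - p))); last first.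
  by move=> k; rewrite -natr1; ring.
rewrite (@eq_binE _ _ _ (_ \o _) (fun k => k%:R - m%:R * p + (c + 1 - p))); last first.
  by move=> k /=; rewrite -!natr1; ring.
by rewrite !IH; ring.
Qed.

Section grid.
Variables (R : realType) (d : nat).
Implicit Types (x y : 'rV[R]_d) (k l : {ffun 'I_d -> nat}) (G F : 'rV[R]_d -> R).

Definition gridpt m k : 'rV[R]_d := \row_j ((k j)%:R / m%:R).

Lemma gridpt_natk m (k : {ffun 'I_d -> 'I_m.+1}) : gridpt m (natk k) = kpoint R k.
Proof. by apply/rowP => j; rewrite !mxE ffunE. Qed.

Lemma inS_inbox x : inS x -> inbox x. Proof. by case. Qed.

Lemma inS_sum x : inS x -> \sum_(j < d) x ord0 j <= 1.
Proof. by move=> [x01 x1]; rewrite -l1_nonneg_sum// => j; case/andP: (x01 j). Qed.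

Lemma inS_gridpt m k : (0 < m)%N -> (\sum_(j < d) k j <= m)%N -> inS (gridpt m k).
Proof.
move=> m0 km; split=> [j|].
  rewrite mxE divr_ge0//= ler_pdivrMr ?ltr0n// mul1r ler_nat.
  by rewrite (leq_trans _ km)// (bigD1 j)//= leq_addr.
rewrite l1_nonneg_sum => [|j]; last by rewrite mxE divr_ge0.
under eq_bigr do rewrite mxE.
by rewrite -mulr_suml -natr_sum ler_pdivrMr ?ltr0n// mul1r ler_nat.
Qed.

Lemma inS_minvec x y : inS x -> inS y -> inS (minvec x y).
Proof.
move=> xS yS; have [xb _] := xS; have [yb _] := yS.
have h j : 0 <= minvec x y ord0 j <= x ord0 j.
  have /andP[x0 _] := xb j; have /andP[y0 _] := yb j.
  by rewrite mxE le_min x0 y0 ge_min lexx.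
split=> [j|].
  have /andP[m0 m1] := h j; have /andP[_ x1] := xb j.
  by rewrite m0 (le_trans m1).
rewrite l1_nonneg_sum => [|j]; last by case/andP: (h j).
apply: le_trans (inS_sum xS); apply: ler_sum => j _.
by case/andP: (h j).
Qed.

(** * Moments of a multinomial grid point *)

Section moments.
Variables (x : 'rV[R]_d) (m : nat).
Hypotheses (xS : inS x) (m0 : (0 < m)%N).

Let m0R : m%:R != 0 :> R. Proof. by rewrite pnatr_eq0 -lt0n. Qed.
Let x0 j : 0 <= x ord0 j. Proof. by case/andP: (xS.1 j). Qed.
Let x1 : \sum_(j < d) x ord0 j <= 1. Proof. exact: inS_sum. Qed.

Lemma mulE_gridpt_mean i :
  mulE x m (fun k => gridpt m k ord0 i - x ord0 i) = 0.
Proof.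
rewrite (@eq_mulE _ _ _ _ _ (fun k => m%:R^-1 * ((k i)%:R - m%:R * x ord0 i + 0))); last first.
  by move=> k; rewrite mxE; field.
by rewrite mulEZ (mulE_coord x m (fun r => r%:R - m%:R * x ord0 i + 0)) binE_mean mulr0.
Qed.

Lemma mulE_gridpt_cov i j :
  mulE x m (fun k => (gridpt m k ord0 i - x ord0 i) * (gridpt m k ord0 j - x ord0 j))
  = m%:R^-1 * ((i == j)%:R * x ord0 i - x ord0 i * x ord0 j).
Proof.
rewrite (@eq_mulE _ _ _ _ _ (fun k => m%:R^-2 * (((k i)%:R - m%:R * x ord0 i + 0)
   * ((k j)%:R - m%:R * x ord0 j + 0)))); last first.
  by move=> k; rewrite !mxE; field.
by rewrite mulEZ mulE_cov; field.
Qed.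

Lemma mulE_sqdist_le : mulE x m (fun k => sqdist x (gridpt m k)) <= d%:R / m%:R.
Proof.
rewrite mulE_sum.
rewrite -[leRHS](_ : \sum_(i < d) m%:R^-1 = _); last by rewrite sumr_const card_ord mulr_natl.
apply: ler_sum => i _.
rewrite (eq_mulE _ _ (fun k => expr2 _)) mulE_gridpt_cov eqxx mul1r.
have /andP[? ?] := xS.1 i.
by rewrite ler_piMr ?invr_ge0//; nra.
Qed.

(** The 4 is 1 + 3: with $v=p(1-p)\in[0,1]$, the two parts of the fourth moment of the count are at
    most $m^2$ and $3m^2$. *)
Lemma mulE_gridpt_fourth i :
  mulE x m (fun k => (gridpt m k ord0 i - x ord0 i) ^+ 4) <= 4 / m%:R ^+ 2.
Proof.
rewrite (@eq_mulE _ _ _ _ _ (fun k => m%:R^-4 * ((k i)%:R - m%:R * x ord0 i + 0) ^+ 4)); last first.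
  by move=> k; rewrite !mxE; field.
rewrite mulEZ (mulE_coord x m (fun r => (r%:R - m%:R * x ord0 i + 0) ^+ 4)) binE_fourth.
have /andP[p0 p1] := xS.1 i.
set p := x ord0 i in p0 p1 *.
rewrite expr0n/= expr0n/= !mulr0 !mul0r !add0r mulrC ler_pdivrMr ?exprn_gt0 ?ltr0n//.
have -> : 4 / m%:R ^+ 2 * m%:R ^+ 4 = 4 * m%:R ^+ 2 :> R by field.
have v0 : 0 <= p * (1 - p) by nra.
have v1 : p * (1 - p) <= 1 by nra.
have m1 : 1 <= m%:R :> R by rewrite ler1n.
move: (p * (1 - p)) v0 v1 => v v0 v1.
have h1 : m%:R * (v * (1 - 3 * v)) <= m%:R * m%:R.
  by rewrite ler_wpM2l//; nra.
have h2 : 3 * m%:R * (m%:R - 1) * v ^+ 2 <= 3 * m%:R * m%:R.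
  rewrite -[leRHS]mulr1 ler_pM ?sqr_ge0//.
  - by rewrite mulr_ge0 ?subr_ge0.
  - by rewrite ler_wpM2l// gerBl.
  - by rewrite expr_le1.
by rewrite expr2; lra.
Qed.

Lemma mulE_sqdist_sqr_le :
  mulE x m (fun k => sqdist x (gridpt m k) ^+ 2) <= 4 * d%:R ^+ 2 / m%:R ^+ 2.
Proof.
apply: (@le_trans _ _ (mulE x m (fun k => d%:R *
    \sum_(i < d) (gridpt m k ord0 i - x ord0 i) ^+ 4))).
  apply: ler_mulE => // k _.
  rewrite expr2 /sqdist big_distrlr/=.
  (* Applied to the vector of squared deviations, this bounds the squared sum by [d] times the sum
     of fourth powers. *)
  have := sum_norm_mul_le (\row_i (gridpt m k ord0 i - x ord0 i) ^+ 2).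
  have -> : \sum_(i < d) (\row_i0 (gridpt m k ord0 i0 - x ord0 i0) ^+ 2) ord0 i ^+ 2
    = \sum_(i < d) (gridpt m k ord0 i - x ord0 i) ^+ 4.
    by apply: eq_bigr => i _; rewrite mxE -exprM.
  apply: le_trans; apply: ler_sum => i _; apply: ler_sum => j _.
  by rewrite !mxE ler_norm.
rewrite mulEZ mulE_sum.
rewrite (_ : 4 * d%:R ^+ 2 / m%:R ^+ 2 = d%:R * \sum_(i < d) (4 / m%:R ^+ 2)); last first.
  by rewrite sumr_const card_ord -(mulr_natl (4 / m%:R ^+ 2)); ring.
by rewrite ler_wpM2l//; apply: ler_sum => i _; exact: mulE_gridpt_fourth.
Qed.
End moments.

(** The linear term has mean 0 and the Hessian term has mean $B/m$, so only the Taylor remainder is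
    left. Its constant depends on the cube and not on [x], which makes the bias uniform. *)
Lemma bias_bound G (eps : R) : C2 G -> 0 < eps ->
  exists2 C, 0 <= C & forall x m, inS x -> (0 < m)%N ->
  `|m%:R * (mulE x m (fun k => G (gridpt m k)) - G x) - Bfun G x| <= eps + C / m%:R.
Proof.
move=> G2 eps0; pose e := eps / d.+1%:R.
have e0 : 0 < e by rewrite divr_gt0.
have [C C0 CP] := taylor2_inbox G2 e0.
exists (C * (4 * d%:R ^+ 2)); first by rewrite !mulr_ge0// exprn_ge0.
move=> x m xS m0.
have m0R : 0 < m%:R :> R by rewrite ltr0n.
have xb j : 0 <= x ord0 j by case/andP: (xS.1 j).
have x1 := inS_sum xS.
pose T k := G (gridpt m k) - G x
  - \sum_(i < d) (gridpt m k ord0 i - x ord0 i) * partial i G x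
  - 2^-1 * hess G x (gridpt m k - x).
have ET : mulE x m T = mulE x m (fun k => G (gridpt m k)) - G x - m%:R^-1 * Bfun G x.
  rewrite /T.
  rewrite (@eq_mulE _ _ _ _ _ (fun k => (-1) *
      (\sum_(i < d) partial i G x * (gridpt m k ord0 i - x ord0 i)) +
    ((- 2^-1) * (\sum_(i < d) \sum_(j < d) partial j (partial i G) x *
       ((gridpt m k ord0 i - x ord0 i) * (gridpt m k ord0 j - x ord0 j)))
     + (G (gridpt m k) + (- G x))))); last first.
    move=> k.
    have -> : \sum_(i < d) partial i G x * (gridpt m k ord0 i - x ord0 i) =
       \sum_(i < d) (gridpt m k ord0 i - x ord0 i) * partial i G x.
      by apply: eq_bigr => i _; rewrite mulrC.
    have -> : \sum_(i < d) \sum_(j < d) partial j (partial i G) x *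
       ((gridpt m k ord0 i - x ord0 i) * (gridpt m k ord0 j - x ord0 j))
       = hess G x (gridpt m k - x).
      apply: eq_bigr => i _; apply: eq_bigr => j _.
      by rewrite mulrC !mxE.
    by move: (\sum_(i < d) _) (hess _ _ _) => a b; ring.
  rewrite !mulE_linear mulED mulE_cst !mulE_sum.
  rewrite big1 => [|i _]; last by rewrite mulEZ mulE_gridpt_mean// mulr0.
  have -> : Bfun G x = 2^-1 * (m%:R * \sum_(i < d) mulE x m (fun k =>
      \sum_(j < d) partial j (partial i G) x *
       ((gridpt m k ord0 i - x ord0 i) * (gridpt m k ord0 j - x ord0 j)))).
    congr (_ * _); rewrite mulr_sumr; apply: eq_bigr => i _.
    rewrite mulE_sum mulr_sumr; apply: eq_bigr => j _.
    by rewrite mulEZ mulE_gridpt_cov//; field; rewrite lt0r_neq0.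
  by field; rewrite lt0r_neq0.
have -> : m%:R * (mulE x m (fun k => G (gridpt m k)) - G x) - Bfun G x = m%:R * mulE x m T.
  by rewrite ET; field; rewrite lt0r_neq0.
have TB : `|mulE x m T| <= e * (d%:R / m%:R) + C * (4 * d%:R ^+ 2 / m%:R ^+ 2).
  rewrite (le_trans (ler_norm_mulE m T xb x1))//.
  apply: (@le_trans _ _ (mulE x m (fun k => e * sqdist x (gridpt m k)
     + C * sqdist x (gridpt m k) ^+ 2))).
    apply: ler_mulE => // k km; apply: CP; first exact: inS_inbox.
    exact/inS_inbox/inS_gridpt.
  rewrite mulE_linear mulEZ lerD// ler_wpM2l ?(ltW e0)//; first exact: mulE_sqdist_le.
  exact: mulE_sqdist_sqr_le.
rewrite normrM (ger0_norm (ltW m0R)).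
apply: (le_trans (ler_wpM2l (ltW m0R) TB)).
rewrite mulrDr; apply: lerD.
  rewrite mulrCA (mulrC m%:R) divfK ?lt0r_neq0// /e mulrAC ler_pdivrMr//.
  by rewrite ler_wpM2l ?(ltW eps0)// ler_nat.
by rewrite le_eqVlt; apply/orP; left; apply/eqP; field; rewrite lt0r_neq0.
Qed.

Lemma minr_centered (a b c : R) :
  Num.min a b - c = 2^-1 * (a - c) + 2^-1 * (b - c) - 2^-1 * `|a - b|.
Proof.
case: (leP a b) => [ab|/ltW ba].
  by rewrite ler0_norm ?subr_le0//; field.
by rewrite ger0_norm ?subr_ge0//; field.
Qed.

(** The decomposition is $A-M^2-G(1-G)=(A-G)-(M-G)(M+G)$, with $M-G=O(1/m)$; the term of order
    $m^{-1/2}$ comes from $A-G$ alone. At an interior point every $x_i$ is strictly between 0 and 1,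
    as [diffE_absz] requires. *)
Lemma variance_bound G x : C2 G -> inIntS x ->
  exists K, forall m, (0 < m)%N ->
  let A := mulE x m (fun k => mulE x m (fun l => G (minvec (gridpt m k) (gridpt m l)))) in
  let M := mulE x m (fun k => G (gridpt m k)) in
  `|Num.sqrt m%:R * (A - M ^+ 2 - G x * (1 - G x)) + Vfun G x| <= K / Num.sqrt m%:R.
Proof.
move=> G2 xI; have [C C0 CP] := taylor1_inbox G2.
have xS : inS x.
  by split; [move=> j; have /andP[? ?] := xI.1 j; rewrite !ltW|rewrite ltW// xI.2].
pose S := \sum_(i < d) `|partial i G x|.
pose D : R := d%:R.
(* The summands account for the Taylor remainder of [A], the random walk approximation, and
   [M ^+ 2 - G x ^+ 2]. *)
exists (C * (2 * D) + S + C * D * (2 * `|G x| + C * D)).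
move=> m m0; set A := mulE _ _ _; set M := mulE _ _ _; cbv zeta.
have m0R : 0 < m%:R :> R by rewrite ltr0n.
have m1R : 1 <= m%:R :> R by rewrite ler1n.
have m_neq0 := lt0r_neq0 m0R.
have xb j : 0 <= x ord0 j by case/andP: (xS.1 j).
have x1 := inS_sum xS.
pose s := Num.sqrt (m%:R : R).
have s0 : 0 < s by rewrite sqrtr_gt0.
have ss : s * s = m%:R by rewrite -expr2 sqr_sqrtr// ltW.
pose L i := diffE (x ord0 i) m (fun z => `|z|%N%:R) 0.
have MB : `|M - G x| <= C * (D / m%:R).
  have -> : M - G x = mulE x m (fun k => G (gridpt m k) - G x
      - \sum_(i < d) (gridpt m k ord0 i - x ord0 i) * partial i G x).
    rewrite (@eq_mulE _ _ _ _ _ (fun k => (-1) *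
      (\sum_(i < d) partial i G x * (gridpt m k ord0 i - x ord0 i)) +
      (G (gridpt m k) + (- G x)))); last first.
      move=> k; rewrite mulN1r [RHS]addrC; congr (_ - _).
      by apply: eq_bigr => i _; rewrite mulrC.
    rewrite mulE_linear mulED mulE_cst mulE_sum big1 ?mulr0 ?add0r// => i _.
    by rewrite mulEZ mulE_gridpt_mean// mulr0.
  rewrite (le_trans (ler_norm_mulE _ _ xb x1))//.
  apply: (@le_trans _ _ (mulE x m (fun k => C * sqdist x (gridpt m k)))).
    apply: ler_mulE => // k km; apply: CP; first exact: inS_inbox.
    exact/inS_inbox/inS_gridpt.
  by rewrite mulEZ ler_wpM2l//; exact: mulE_sqdist_le.
(* The centered linear parts of the minimum have mean 0; only half the distance between the
   coordinates survives. *)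
have Emin i : mulE x m (fun k => mulE x m (fun l =>
    minvec (gridpt m k) (gridpt m l) ord0 i - x ord0 i)) = - (2^-1 / m%:R * L i).
  pose u k := gridpt m k ord0 i - x ord0 i.
  have mu : mulE x m u = 0 by exact: mulE_gridpt_mean.
  rewrite (@eq_mulE _ _ _ _ _ (fun k => 2^-1 * u k + (- (2^-1 / m%:R)) *
     binE (x ord0 i) m (fun r => (absz (0 + (k i)%:Z - r%:Z)%R)%:R))); last first.
    move=> k; rewrite -(mulE_coord x m (fun r => (absz (0 + (k i)%:Z - r%:Z)%R)%:R)).
    rewrite (@eq_mulE _ _ _ _ _ (fun l => 2^-1 * u l + (2^-1 * u k +
      (- (2^-1 / m%:R)) * (absz (0 + (k i)%:Z - (l i)%:Z)%R)%:R))); last first.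
      move=> l; rewrite mxE minr_centered -/(u k) -/(u l) !mxE -mulrBl normrM.
      rewrite normfV (ger0_norm (ltW m0R)) add0r natr_absz intr_norm rmorphB/=.
      by rewrite -!pmulrn; ring.
    by rewrite mulE_linear mu mulr0 add0r mulED mulE_cst mulEZ.
  rewrite (mulE_linear x m 2^-1 u) mu mulr0 add0r mulEZ mulNr; congr (- (_ * _)).
  exact: (mulE_coord x m (fun r => binE (x ord0 i) m (fun r' => (absz (0 + r%:Z - r'%:Z)%R)%:R))).
have AB : `|A - G x + \sum_(i < d) (2^-1 / m%:R * L i) * partial i G x|
    <= C * (2 * D / m%:R).
  pose y k l := minvec (gridpt m k) (gridpt m l).
  have -> : A - G x + \sum_(i < d) (2^-1 / m%:R * L i) * partial i G x =
      mulE x m (fun k => mulE x m (fun l => G (y k l) - G x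
      - \sum_(i < d) (y k l ord0 i - x ord0 i) * partial i G x)).
    rewrite (@eq_mulE _ _ _ _ _ (fun k => (-1) * (\sum_(i < d) partial i G x *
        mulE x m (fun l => y k l ord0 i - x ord0 i))
      + (mulE x m (fun l => G (y k l)) + (- G x)))); last first.
      move=> k; rewrite (@eq_mulE _ _ _ _ _ (fun l => (-1) *
          (\sum_(i < d) partial i G x * (y k l ord0 i - x ord0 i))
          + (G (y k l) + (- G x)))); last first.
        move=> l; rewrite mulN1r [RHS]addrC; congr (_ - _).
        by apply: eq_bigr => i _; rewrite mulrC.
      rewrite mulE_linear mulED mulE_cst mulE_sum; congr (_ * _ + _).
      by apply: eq_bigr => i _; rewrite mulEZ.
    rewrite mulE_linear mulED mulE_cst mulE_sum mulN1r [RHS]addrC; congr (_ + _).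
    rewrite -sumrN; apply: eq_bigr => i _.
    by rewrite mulEZ Emin mulrN opprK mulrC.
  rewrite (le_trans (ler_norm_mulE _ _ xb x1))//.
  apply: (@le_trans _ _ (mulE x m (fun k => C * sqdist x (gridpt m k) + C * (D / m%:R)))).
    apply: ler_mulE => // k km.
    rewrite (le_trans (ler_norm_mulE _ _ xb x1))//.
    apply: (@le_trans _ _ (mulE x m (fun l => C * sqdist x (gridpt m l)
       + C * sqdist x (gridpt m k)))).
      apply: ler_mulE => // l lm.
      have yS : inS (y k l) by apply: inS_minvec; exact: inS_gridpt.
      rewrite (le_trans (CP _ _ (inS_inbox xS) (inS_inbox yS)))// -mulrDr ler_wpM2l//.
      rewrite addrC /sqdist -big_split/=; apply: ler_sum => i _.
      (* A coordinate of the minimum belongs to one of the two points, so its squared deviation is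
         at most the sum of both. *)
      rewrite [y k l ord0 i]mxE.
      by case: (leP (gridpt m k ord0 i)) => _; rewrite ?lerDl ?lerDr sqr_ge0.
    rewrite mulE_linear mulE_cst addrC lerD2l ler_wpM2l//.
    exact: mulE_sqdist_le.
  rewrite mulE_linear mulE_cst (_ : 2 * D / m%:R = D / m%:R + D / m%:R); last by ring.
  by rewrite mulrDr lerD2r ler_wpM2l//; exact: mulE_sqdist_le.
have VB : `|\sum_(i < d) partial i G x *
    (Num.sqrt (x ord0 i * (1 - x ord0 i) / pi) - 2^-1 / s * L i)| <= S / s.
  rewrite (le_trans (ler_norm_sum _ _ _))// /S mulr_suml; apply: ler_sum => i _.
  rewrite normrM ler_wpM2l// -[leRHS]div1r ler_pdivlMr//.
  have := diffE_absz (xI.1 i) m0; rewrite -/s -/(L i).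
  set q := Num.sqrt _ => h.
  rewrite -{2}(gtr0_norm s0) -normrM.
  (* [diffE_absz] bounds the last factor by 2, hence the product by 1. *)
  have -> : (q - 2^-1 / s * L i) * s = - 2^-1 * (L i - 2 * q * s).
    by field; rewrite lt0r_neq0.
  by rewrite mulNr normrN normrM normfV normr_nat ler_pdivrMl// mulr1.
have -> : s * (A - M ^+ 2 - G x * (1 - G x)) + Vfun G x =
  s * (A - G x + \sum_(i < d) (2^-1 / m%:R * L i) * partial i G x)
  + \sum_(i < d) partial i G x *
    (Num.sqrt (x ord0 i * (1 - x ord0 i) / pi) - 2^-1 / s * L i)
  - s * ((M - G x) * (M + G x)).
  have -> : \sum_(i < d) partial i G x *
    (Num.sqrt (x ord0 i * (1 - x ord0 i) / pi) - 2^-1 / s * L i) =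
    Vfun G x - s * \sum_(i < d) (2^-1 / m%:R * L i) * partial i G x.
    rewrite /Vfun mulr_sumr -sumrB; apply: eq_bigr => i _.
    by rewrite -ss; field; rewrite lt0r_neq0.
  by ring.
have h1 : s * (C * (2 * D / m%:R)) = C * (2 * D) / s.
  by rewrite -ss; field; rewrite lt0r_neq0.
have h2 : s * (C * (D / m%:R) * (2 * `|G x| + C * D)) = C * D * (2 * `|G x| + C * D) / s.
  by rewrite -ss; field; rewrite lt0r_neq0.
rewrite (le_trans (ler_normB _ _))// -/s [leRHS]mulrDl; apply: lerD.
  rewrite (le_trans (ler_normD _ _))// [leRHS]mulrDl; apply: lerD; last by [].
  by rewrite normrM gtr0_norm// -h1 ler_wpM2l// ltW.
rewrite -h2 normrM gtr0_norm// ler_wpM2l ?(ltW s0)// normrM ler_pM//.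
have -> : M + G x = (M - G x) + 2 * G x by ring.
rewrite (le_trans (ler_normD _ _))// [leRHS]addrC; apply: lerD; last first.
  by rewrite normrM normr_nat.
rewrite (le_trans MB)// ler_wpM2l// ler_pdivrMr//.
by rewrite ler_peMr.
Qed.
End grid.

Section bernstein_sums.
Variables (R : realType) (d : nat) (F G : 'rV[R]_d -> R).
Hypothesis FG : forall x, inS x -> G x = F x.
Variables (x : 'rV[R]_d) (m : nat).
Hypotheses (xS : inS x) (m0 : (0 < m)%N).

Let x0 j : 0 <= x ord0 j. Proof. by case/andP: (xS.1 j). Qed.

Lemma inS_kpoint (k : {ffun 'I_d -> 'I_m.+1}) : (ksum k <= m)%N -> inS (kpoint R k).
Proof.
move=> km; rewrite -gridpt_natk; apply: inS_gridpt => //.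
by rewrite (leq_trans _ km)//; apply: eq_leq; apply: eq_bigr => j _; rewrite ffunE.
Qed.

Lemma bernstein_sum_mulE :
  \sum_(k : {ffun 'I_d -> 'I_m.+1} | (ksum k <= m)%N) F (kpoint R k) * bern_weight k x
  = mulE x m (fun k => G (gridpt R m k)).
Proof.
rewrite -bern_weight_sum//; apply: eq_bigr => k km.
by rewrite gridpt_natk FG//; exact: inS_kpoint.
Qed.

Lemma bernstein_sum2_mulE :
  \sum_(k : {ffun 'I_d -> 'I_m.+1} | (ksum k <= m)%N)
     (\sum_(l : {ffun 'I_d -> 'I_m.+1} | (ksum l <= m)%N)
       F (minvec (kpoint R k) (kpoint R l)) * bern_weight l x) * bern_weight k x
  = mulE x m (fun k => mulE x m (fun l => G (minvec (gridpt R m k) (gridpt R m l)))).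
Proof.
rewrite -bern_weight_sum//; apply: eq_bigr => k km; congr (_ * _).
rewrite -bern_weight_sum//; apply: eq_bigr => l lm.
by rewrite !gridpt_natk FG//; apply: inS_minvec; exact: inS_kpoint.
Qed.
End bernstein_sums.

Theorem theorem1 (R : realType) (d : nat) (dT : measure_display)
  (T : measurableType dT) (P : probability T R)
  (X : nat -> T -> 'rV[R]_d) (F G : 'rV[R]_d -> R) (m : nat -> nat) :
  (1 <= d)%N ->
  (* each X_i is a random vector (measurable coordinates) *)
  (forall i (j : 'I_d), measurable_fun setT (fun w => X i w ord0 j)) ->
  (* X_1, X_2, ... are mutually independent *)
  mutually_independent P X ->
  (* each X_i has c.d.f. F *)
  (forall i y, P [set w | le_vec (X i w) y] = (F y)%:E) ->
  (* the distribution is supported on S *)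
  (forall i, P [set w | inS (X i w)] = 1%E) ->
  (* F is twice continuously differentiable on S: it agrees on S with a
     C^2 function G on R^d *)
  C2 G -> (forall x, inS x -> G x = F x) ->
  (* m = m(n) positive, m(n) -> oo *)
  (forall n, (0 < m n)%N) ->
  (forall M : nat, exists N : nat, forall n, (N <= n)%N -> (M <= m n)%N) ->
  (* bias: E[F*_{n,m}(x)] - F(x) = m^-1 B(x) + o(m^-1), uniformly on S *)
  (forall eps : R, 0 < eps -> exists N : nat, forall n, (N <= n)%N ->
     forall x, inS x ->
     `| (m n)%:R * (fine ('E_P[bernstein_cdf X n (m n) x]) - F x) - Bfun G x |
       < eps)
  /\
  (* variance: Var = n^-1 sigma^2 - n^-1 m^-1/2 V + o_x(n^-1 m^-1/2) *)
  (forall x, inIntS x ->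
     (fun n : nat => ((n%:R * Num.sqrt (m n)%:R) *
        (fine ('V_P[bernstein_cdf X n (m n) x])
          - n%:R^-1 * sigma2 F x + n%:R^-1 * (Num.sqrt (m n)%:R)^-1 * Vfun G x)))
     @ \oo --> (0 : R)).
Proof.
move=> _ mX indX cdfX _ G2 FG m0 m_oo.
have large (B : R) : exists N : nat, forall n, (N <= n)%N -> B < (m n)%:R.
  have [N HN] := m_oo (Num.truncn B).+1; exists N => n /HN h.
  by rewrite (lt_le_trans (truncnS_gt _))// ler_nat.
split=> [eps eps0|x xI].
  have e2 : 0 < eps / 2 by rewrite divr_gt0.
  have [C C0 CP] := bias_bound G2 e2.
  (* For large [m] the term $C/m$ is below the other half of [eps]; [N.+1] ensures $n>0$, as the
     moment formulas require. *)
  have [N HN] := large (C / (eps / 2)); exists N.+1 => n Nn x xS.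
  have n0 : (0 < n)%N by exact: leq_trans Nn.
  rewrite (bernstein_cdf_mean mX cdfX)//= (bernstein_sum_mulE FG)// -FG//.
  apply: (le_lt_trans (CP _ _ xS (m0 n))).
  rewrite [ltRHS]splitr ltrD2l ltr_pdivrMr ?ltr0n//.
  by rewrite mulrC -ltr_pdivrMr// HN// ltnW.
have xS : inS x.
  by split; [move=> j; have /andP[? ?] := xI.1 j; rewrite !ltW|rewrite ltW// xI.2].
have [K KP] := variance_bound G2 xI.
apply/cvgrPdist_lt => eps eps0.
(* $m>(K/\varepsilon)^2$ gives $K/\sqrt m<\varepsilon$, whatever the sign of [K]. *)
have [N HN] := large ((K / eps) ^+ 2); exists N.+1 => //= n Nn.
have n0 : (0 < n)%N by exact: leq_trans Nn.
have nR : n%:R != 0 :> R by rewrite pnatr_eq0 -lt0n.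
rewrite sub0r normrN (bernstein_cdf_variance mX indX cdfX)//=.
rewrite (bernstein_sum_mulE FG)// (bernstein_sum2_mulE FG)// /sigma2 -FG//.
have s0 : 0 < Num.sqrt (m n)%:R :> R by rewrite sqrtr_gt0 ltr0n.
have := KP _ (m0 n); rewrite /=.
set A := mulE _ _ _; set M := mulE _ _ _; set s := Num.sqrt _ in s0 *.
have -> : n%:R * s * (n%:R^-1 * (A - M ^+ 2) - n%:R^-1 * (G x * (1 - G x))
    + n%:R^-1 * s^-1 * Vfun G x) = s * (A - M ^+ 2 - G x * (1 - G x)) + Vfun G x.
  by field; rewrite nR lt0r_neq0.
move=> /le_lt_trans; apply.
rewrite ltr_pdivrMr// mulrC -ltr_pdivrMr//.
apply: (le_lt_trans (ler_norm _)).
rewrite -sqrtr_sqr ltr_sqrt ?ltr0n//.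
by apply: HN; exact: ltnW.
Qed.
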